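(* Let $G=(V,E)$ be a fullerene graph with $n=|V|$ vertices, and let $\operatorname{perfmat} G$ be its number of perfect matchings. Then: (1) if $G$ has a hamiltonian cycle and $n$ is divisible by $4$, then $\operatorname{perfmat} G\le 8^{\frac n8}$; (2) if $G$ has a hamiltonian cycle and $n$ is not divisible by $4$, then $\operatorname{perfmat} G\le 8^{\frac{n-2}{8}}\sqrt3$; (3) in all cases, $\operatorname{perfmat} G\le 8^{\frac14\lfloor\frac{5n-4}{12}\rfloor}\,3^{\frac{n-2\lfloor\frac{5n-4}{12}\rfloor}{4}}$.
   Context: A fullerene graph is a planar cubic ($3$-regular) simple graph, embedded in the plane so that every face, including the unbounded one, is a pentagon or a hexagon (bounded by a cycle of length $5$ or $6$). *)

(* Defs.v *)
From HB Require Import structures.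
From mathcomp Require Import all_boot all_order all_algebra perm.
From mathcomp Require Import reals exp.

Set Implicit Arguments.
Unset Strict Implicit.
Unset Printing Implicit Defensive.

Record sgraph := SGraph {
  vertex :> finType;
  adj : rel vertex;
  adj_sym : symmetric adj;
  adj_irr : irreflexive adj }.

Section Graph.
Variable G : sgraph.

Definition edges : {set {set G}} :=
  [set f | [exists x : G, exists y : G, adj x y && (f == [set x; y])]].

Definition cubic : Prop := forall v : G, #|[set w | adj v w]| = 3.

Definition perfect_matching (M : {set {set G}}) : bool :=
  (M \subset edges) && [forall v : G, #|[set f in M | v \in f]| == 1].

Definition perfmat : nat := #|[set M | perfect_matching M]|.

Definition hamiltonian : Prop :=
  exists c : seq G,
    [/\ 2 < size c, ucycle (@adj G) c & forall v : G, v \in c].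

(* An embedding of G in an oriented closed surface is encoded by its rotation *)
(* system: for each vertex, the cyclic order of the edges leaving it.         *)

Definition dart : finType := {d : G * G | adj d.1 d.2}.

Definition src (d : dart) : G := (val d).1.

Lemma rev_dart_subproof (d : dart) : adj (val d).2 (val d).1.
Proof. by rewrite adj_sym; exact: valP d. Qed.

Definition rev_dart (d : dart) : dart :=
  exist _ ((val d).2, (val d).1) (rev_dart_subproof d).

(* Each orbit of sigma consists of all the darts leaving one vertex.          *)
Definition rotation (sigma : {perm dart}) : Prop :=
  forall d d' : dart, fconnect sigma d d' = (src d == src d').

(* The face orbits list the darts met when walking around a face; the source  *)
(* of face_next d is the target of d.                                         *)
Definition face_next (sigma : {perm dart}) (d : dart) : dart :=
  sigma (rev_dart d).

Definition nb_faces (sigma : {perm dart}) : nat := fcard (face_next sigma) dart.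

(* Genus 0 for a connected graph, i.e. the surface is the sphere; the sphere  *)
(* and the plane carry the same embeddings, the unbounded face of a plane     *)
(* embedding being one of the face orbits.                                    *)
Definition plane_rotation (sigma : {perm dart}) : Prop :=
  rotation sigma /\ #|G| + nb_faces sigma = #|edges| + 2.

Definition face_walk (sigma : {perm dart}) (d : dart) : seq G :=
  map src (fingraph.orbit (face_next sigma) d).

Definition pentagon_or_hexagon (s : seq G) : Prop :=
  ucycle (@adj G) s /\ (size s = 5 \/ size s = 6).

(* In the plane, connectedness follows from each face being bounded by a      *)
(* single cycle; a rotation system does not see how components are placed     *)
(* relative to each other, so it is required explicitly.                      *)
Definition fullerene : Prop :=
  [/\ cubic, forall x y : G, connect (@adj G) x y &
      exists2 sigma : {perm dart}, plane_rotation sigma &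
        forall d : dart, pentagon_or_hexagon (face_walk sigma d)].

End Graph.

(* Main.v *)
Require Import Defs.
From HB Require Import structures.
From mathcomp Require Import all_boot all_order all_algebra all_field perm.
From mathcomp Require Import reals exp.
From mathcomp Require Import ring lra zify.

(* The Hadamard-type bound perfmat G ^ 8 <= 8 ^ n holds for every fullerene,  *)
(* hamiltonian or not, and it implies the three bounds.                       *)
(*                                                                            *)
(* By Kasteleyn, the darts can be signed so that the skew-symmetric adjacency *)
(* matrix K satisfies det K = (perfmat G) ^ 2: every face gets an odd number  *)
(* of negative darts, and then so does every even cycle whose inside has an   *)
(* even number of vertices. On the sphere such a signing exists, and every    *)
(* cycle bounds a set of faces, because by Euler's formula the sequence       *)
(* faces -> edges -> vertices over F_2 is exact in the middle.                *)
(*                                                                            *)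
(* A fullerene has no 4-cycle: a 4-cycle would have two of the remaining four *)
(* edges on each side, hence would be surrounded by hexagons that produce     *)
(* further 4-cycles of the same kind; then all the faces would be hexagons.   *)
(* Therefore the squared moduli t of the eigenvalues of K, which lie in       *)
(* [0, 9], have mean 3 and mean square 9 + 6 = 15, and since they are not     *)
(* concentrated at 3, AM-GM applied to a quadratic majorant of the square     *)
(* root of t / 3 bounds their product by (3 (23/24)^2)^n <= 8^(n/2).          *)

(** The estimate is the chain perfmat^8 <= [#|even_walks|]^4 = (det K)^4 <= 8^n, proved in
    [perfmat_pow8_le].

    Left inequality: two perfect matchings overlap in doubled edges and even cycles. Directing every
    such cycle by a canonical rule yields a permutation from which the pair can be read back
    ([superposition]), so perfmat^2 is at most the number of permutations that move every vertex to
    a neighbour and have only even cycles.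

    Equality: in the Leibniz expansion of det K, the permutations with an odd cycle cancel under
    reversal of that cycle ([skew_det_even]). The signing from [odd_face_orientation] turns each
    remaining nonzero term into 1 ([odd_perm_sign], [det_kast]); the topological content is
    [even_boundary] and [odd_long_cycle].

    Right inequality: by [no_four_cycle], two distinct vertices have at most one common neighbour,
    so the traces of K^2 and K^4 depend on n alone, and [det_skew_le] bounds the determinant.

    The eighth powers of the three claimed bounds are 8^n, 81 * 8^(n-2) and 8^(2k) * 9^(n-2k), all
    at least 8^n. *)

Set Implicit Arguments.
Unset Strict Implicit.
Unset Printing Implicit Defensive.
Import Order.TTheory GRing.Theory Num.Theory.

(** * Darts and rotation systems *)

Section Darts.
Variable G : sgraph.
Implicit Types d : dart G.

Definition tgt d : G := (val d).2.

Lemma dart_inj d d' : src d = src d' -> tgt d = tgt d' -> d = d'.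
Proof.
by rewrite /src /tgt => e1 e2; apply: val_inj;
  rewrite [LHS]surjective_pairing e1 e2 -surjective_pairing.
Qed.

Lemma dart_adj d : adj (src d) (tgt d).
Proof. exact: (valP d). Qed.

Definition mkdart (u v : G) (uv : adj u v) : dart G := exist _ (u, v) uv.

Lemma src_rev d : src (rev_dart d) = tgt d. Proof. by []. Qed.
Lemma tgt_rev d : tgt (rev_dart d) = src d. Proof. by []. Qed.

Lemma rev_dartK : involutive (@rev_dart G).
Proof. by move=> d; apply: dart_inj. Qed.

Lemma rev_dart_inj : injective (@rev_dart G).
Proof. exact: inv_inj rev_dartK. Qed.

Lemma src_neq_tgt d : src d != tgt d.
Proof. by apply/eqP=> E; have := dart_adj d; rewrite E adj_irr. Qed.

Lemma rev_dart_neq d : rev_dart d != d.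
Proof. by apply/eqP=> /(congr1 (@src G)) /eqP;
  rewrite src_rev eq_sym (negPf (src_neq_tgt d)). Qed.

Lemma card_out_darts (v : G) : #|[set d : dart G | src d == v]| = #|[set w | adj v w]|.
Proof.
have <- : (@tgt @: [set d : dart G | src d == v]) = [set w | adj v w].
  apply/setP=> w; rewrite inE; apply/imsetP/idP => [[d]|vw].
    by rewrite inE => /eqP <- ->; exact: dart_adj.
  by exists (mkdart vw); rewrite ?inE.
rewrite card_in_imset // => d d'; rewrite !inE => /eqP sd /eqP sd' tE.
by apply: dart_inj => //; rewrite sd sd'.
Qed.

Definition edge_set d : {set G} := [set src d; tgt d].

Lemma edge_set_in d : edge_set d \in edges G.
Proof.
rewrite inE; apply/existsP; exists (src d); apply/existsP; exists (tgt d).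
by rewrite dart_adj eqxx.
Qed.

Lemma eq_edge_set d d' : (edge_set d' == edge_set d) = (d' == d) || (d' == rev_dart d).
Proof.
apply/eqP/orP => [E|[]/eqP->]; rewrite /edge_set //; last by rewrite setUC.
have xin : src d \in edge_set d' by rewrite E set21.
have yin : tgt d \in edge_set d' by rewrite E set22.
have nd := src_neq_tgt d.
move: xin yin; rewrite !inE => /orP[]/eqP xE /orP[]/eqP yE.
- by case/eqP: nd; rewrite xE yE.
- by left; apply/eqP; apply: dart_inj.
- by right; apply/eqP; apply: dart_inj.
- by case/eqP: nd; rewrite xE yE.
Qed.

Lemma card_edges : #|dart G| = 2 * #|edges G|.
Proof.
rewrite -[LHS]sum1_card (partition_big edge_set (mem (edges G))) => [|d _];
  last exact: edge_set_in.
rewrite /= mulnC -sum_nat_const; apply: eq_bigr => e; rewrite inE.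
case/existsP=> x /existsP[y /andP[xy /eqP ->]]; pose d := mkdart xy.
rewrite -[[set x; y]]/(edge_set d) sum1dep_card (_ : [set _ | _] = [set d; rev_dart d]).
  by rewrite cards2 eq_sym rev_dart_neq.
by apply/setP=> d'; rewrite !inE eq_edge_set.
Qed.

Lemma card_darts : cubic G -> #|dart G| = 3 * #|G|.
Proof.
move=> cubicG; rewrite -[LHS]sum1_card (partition_big (@src G) xpredT) //= mulnC
  -sum_nat_const.
by apply: eq_bigr => v _; rewrite sum1dep_card card_out_darts cubicG.
Qed.

Lemma connect_darts (connG : forall x y : G,
  connect (@adj G) x y) (P : G -> Prop) (v0 : G) :
  P v0 -> (forall d, P (src d) -> P (tgt d)) -> forall v, P v.
Proof.
move=> P0 cl v; have /connectP[p] := connG v0 v.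
elim: p v0 P0 => [|w p IH] v0 P0 /= => [_ ->//|/andP[vw pp] ev].
exact: IH (cl (mkdart vw) P0) pp ev.
Qed.

End Darts.

Section Rotation.
Variables (G : sgraph) (sigma : {perm dart G}).
Hypotheses (cubicG : cubic G) (rotG : rotation sigma).
Implicit Types d : dart G.

Local Notation L := (face_next sigma).
Local Notation rd := (@rev_dart G).

Definition right_next d : dart G := sigma (sigma (rev_dart d)).
Local Notation R := right_next.

Lemma order_sigma d : order sigma d = 3.
Proof.
rewrite -(cubicG (src d)) -card_out_darts /order; apply: eq_card => d'.
by rewrite inE -topredE /= rotG eq_sym.
Qed.

Lemma sigma3 d : sigma (sigma (sigma d)) = d.
Proof. by have := iter_order (@perm_inj _ sigma) d; rewrite order_sigma. Qed.

Lemma src_sigma d : src (sigma d) = src d.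
Proof. by apply/eqP; rewrite eq_sym -rotG fconnect1. Qed.

Lemma sigma_orbit d d' : src d = src d' -> [\/ d' = d, d' = sigma d | d' = sigma (sigma d)].
Proof.
move/eqP; rewrite -rotG fconnect_orbit /fingraph.orbit order_sigma !inE.
by case/or3P => /eqP ->; [constructor 1|constructor 2|constructor 3].
Qed.

Lemma sigma_orbit_uniq d : uniq [:: d; sigma d; sigma (sigma d)].
Proof. by have := orbit_uniq sigma d; rewrite /fingraph.orbit order_sigma. Qed.

Lemma sigma_neq d : sigma d <> d.
Proof. by have := sigma_orbit_uniq d => /= /[!inE] /and3P[/norP[/eqP nd _] _ _] /esym. Qed.

Lemma sigma2_neq d : sigma (sigma d) <> d.
Proof. by move=> E; have := sigma3 d; rewrite E => /sigma_neq. Qed.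

Lemma face_next_inj : injective L.
Proof. by move=> d d' /perm_inj /rev_dart_inj. Qed.

Lemma src_face_next d : src (L d) = tgt d.
Proof. by rewrite src_sigma. Qed.

Lemma face_nextP d d' : src d' = tgt d -> [\/ d' = rd d, d' = L d | d' = R d].
Proof. by rewrite -src_rev => /esym/sigma_orbit. Qed.

Lemma sigma_face_next d : sigma (L d) = R d. Proof. by []. Qed.

Lemma face_next_rev d : L (rd d) = sigma d.
Proof. by rewrite /face_next rev_dartK. Qed.

Lemma right_next_rev d : R (rd d) = sigma (sigma d).
Proof. by rewrite /right_next rev_dartK. Qed.

(** Traversing a walk backwards exchanges left and right turns, because [sigma] has order 3. *)
Lemma rev_face_next d d' : d' = L d -> rd d = R (rd d').
Proof. by move=> ->; rewrite right_next_rev sigma3. Qed.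

Lemma rev_right_next d d' : d' = R d -> rd d = L (rd d').
Proof. by move=> ->; rewrite face_next_rev sigma3. Qed.

(** Induction over all darts: [sigma] is [L] after reversal, so closure under both carries a
    property around each vertex and then along edges. *)
Lemma dart_connected (connG : forall x y : G,
  connect (@adj G) x y) (P : dart G -> Prop) d0 : P d0 ->
  (forall d, P d -> P (L d)) -> (forall d, P d -> P (rd d)) -> forall d, P d.
Proof.
move=> P0 PL Pr d; suff : forall v, (forall x, src x = v -> P x) by apply.
have P3 y : P y -> forall x, src x = src y -> P x.
  have Ps z : P z -> P (sigma z) by move=> Pz; rewrite -face_next_rev; apply/PL/Pr.
  by move=> Py x /esym/sigma_orbit[->|->|->] //; [exact: Ps|exact/Ps/Ps].
apply: (connect_darts connG (v0 := src d0)); first exact: P3.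
by move=> y Hy z zt; apply: (P3 (rd y)) => //; apply/Pr/Hy.
Qed.

End Rotation.

(** * Fullerenes have no 4-cycle *)

Section FourCycles.
Variables (G : sgraph) (sigma : {perm dart G}).
Hypotheses (cubicG : cubic G) (rotG : rotation sigma).
Hypothesis faceG : forall d : dart G, pentagon_or_hexagon (face_walk sigma d).
Hypothesis connG : forall x y : G, connect (@adj G) x y.
Hypothesis eulerG : #|G| + nb_faces sigma = #|edges G| + 2.
Implicit Types d : dart G.

Local Notation L := (face_next sigma).
Local Notation R := (right_next sigma).
Local Notation rd := (@rev_dart G).

Lemma order_face d : order L d = 5 \/ order L d = 6.
Proof. by case: (faceG d) => _; rewrite size_map size_orbit. Qed.

Lemma uniq_face_walk d : uniq (map (@src G) (fingraph.orbit L d)).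
Proof. by case: (faceG d) => /andP[]. Qed.

Lemma src_iter_face d i : 0 < i < 5 -> src (iter i L d) <> src d.
Proof.
move=> /andP[i0 i5] E; have := uniq_face_walk d.
have sz : size [seq src i | i <- fingraph.orbit L d] =
  order L d by rewrite size_map size_orbit.
have o5 : 5 <= order L d by case: (order_face d) => ->.
have io : i < order L d by apply: leq_trans o5.
have oo : 0 < order L d by apply: leq_trans o5.
move=> un; have := @nth_uniq _ (src d) _ i 0 _ _ un; rewrite sz io oo => /(_ isT isT).
rewrite !(nth_map d) ?size_orbit // !nth_traject //= E eqxx => /esym /eqP i00.
by rewrite i00 in i0.
Qed.

Lemma face_cases d : iter 5 L d = d \/ iter 6 L d = d /\ iter 5 L d <> d.
Proof.
have Linj := @face_next_inj _ sigma.
case: (order_face d) => o; [left|right]; have := iter_order Linj d; rewrite o //.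
move=> E; split=> // E5; move: E; rewrite iterS E5 => Ed.
have := @src_iter_face d 1 isT; by rewrite /= Ed.
Qed.

(* A closed walk of length four is coded by its turns; the turns L L R R and  *)
(* L R L R are the two ways to have two of the remaining edges on each side.  *)
Definition ladder d := R (R (L (L d))) = d.
Definition tube d := R (L (R (L d))) = d.

Let revL d d' : d' = L d -> rd d = R (rd d'). Proof. exact: rev_face_next. Qed.
Let revR d d' : d' = R d -> rd d = L (rd d'). Proof. exact: rev_right_next. Qed.
Let RE d : sigma (L d) = R d. Proof. by []. Qed.
Let LrE d : L (rd d) = sigma d. Proof. exact: face_next_rev. Qed.
Let srcL d : src (L d) = tgt d. Proof. exact: src_face_next. Qed.
Let RrE d : R (rd d) = sigma (sigma d). Proof. exact: right_next_rev. Qed.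

Lemma ladder_rev d : ladder d -> ladder (rd d).
Proof.
move=> D; have e4 := revR (esym D); have e3 := revR (erefl (R (L (L d)))).
have e2 := revL (erefl (L (L d))); have e1 := revL (erefl (L d)).
by rewrite /ladder -e4 -e3 -e2 -e1.
Qed.

(** The face of [rd d] runs backwards along three edges of the 4-cycle. It must be a hexagon, and
    the face across its next edge contains the fourth edge; together they exhibit a further ladder
    that shares this fourth edge. *)
Lemma ladder_step d : ladder d ->
  [/\ iter 6 L (rd d) = rd d, iter 5 L (rd d) <> rd d &
      ladder (rd (iter 3 L (rd d))) /\ L (rd (iter 3 L (rd d))) = rd (L d)].
Proof.
move=> D; have e4 := revR (esym D); have e3 := revR (erefl (R (L (L d)))).
have e2 := revL (erefl (L (L d))).
have E3 : L (L (rd d)) = rd (L (L d)) by rewrite -e4 -e3.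
have g1 : L (rd (iter 3 L (rd d))) = rd (L d) by rewrite LrE /= RE E3 -e2.
have g2 : L (rd (L d)) = R d by rewrite LrE.
(* If the face were a pentagon, the face across its fourth edge would close up after three steps. *)
case: (face_cases (rd d)) => [E5|[E6 N5]].
  have := @src_iter_face (rd (iter 3 L (rd d))) 3 isT.
  rewrite !iterS g1 g2; have := revL (esym E5); rewrite rev_dartK => <-.
  by case; rewrite srcL tgt_rev src_rev; exact: srcL.
split=> //; split; last exact: g1.
rewrite /ladder g1 g2; have := revL (esym E6); rewrite rev_dartK => <-.
by rewrite -(revL (erefl (iter 5 L (rd d)))) -(revL (erefl (iter 4 L (rd d)))).
Qed.

(** With only hexagons, 6F = 2E = 3V, so V - E + F would be 0 instead of 2. *)
Lemma not_all_hexagons : ~ forall d, order L d = 6.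
Proof.
move=> all6.
have := @fcard_order_set _ _ (@face_next_inj _ sigma) 6 (mem (dart G)).
rewrite -/(nb_faces sigma); move: eulerG (card_darts cubicG) (card_edges G).
set f := nb_faces sigma => eu cd ce /(_ _ _) H.
have : f * 6 = #|dart G|.
  by apply: H; [apply/subsetP=> d _; rewrite inE all6|move=> x y _; rewrite !inE].
by move=> F6; lia.
Qed.

Lemma order_face6 d : iter 5 L d <> d -> order L d = 6.
Proof.
move=> N5; case: (order_face d) => // o; case: N5.
by rewrite -o; apply: iter_order (@face_next_inj _ sigma) _.
Qed.

Lemma order_face_next d : order L (L d) = order L d.
Proof.
by apply/esym/eq_card => x; rewrite !inE; exact: (same_fconnect1 (@face_next_inj _ sigma)).
Qed.

Lemma no_ladder d : ~ ladder d.
Proof.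
move=> D0; apply: not_all_hexagons.
(* The darts lying on ladders are closed under [L] and reversal, hence are all the darts; and every
   dart on a ladder belongs to a hexagon. *)
pose T x := exists2 d, ladder d & [\/ x = d, x = L d, x = L (L d) | x = R (L (L d))].
have Trd x : T x -> T (rd x).
  case=> e De Hx; exists (rd e); first exact: ladder_rev.
  have e4 := revR (esym De); have e3 := revR (erefl (R (L (L e)))).
  have e2 := revL (erefl (L (L e))).
  case: Hx => ->; [constructor 1|constructor 4|constructor 3|constructor 2] => //.
    by rewrite -e4 -e3 -e2.
  by rewrite -e4 -e3.
have TL x : T x -> T (L x).
  case=> e De; case=> ->.
  - by exists e => //; constructor 2.
  - by exists e => //; constructor 3.
  - have [_ _ [D' _]] := ladder_step (ladder_rev De).
    rewrite rev_dartK in D'; rewrite -[L _](rev_dartK _); apply: Trd.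
    by exists (rd (L (L (L e)))) => //; constructor 1.
  - have [_ _ [D' E]] := ladder_step (ladder_rev De).
    rewrite rev_dartK in D' E.
    have e4 := revR (esym De).
    exists (rd (L (L (L e)))) => //; constructor 3.
    by rewrite E -e4 rev_dartK.
have Tall : forall x, T x.
  by apply: (dart_connected cubicG rotG connG (d0 := d)) => //; exists d => //;
    constructor 1.
have hex e : ladder e -> order L e = 6.
  move=> /ladder_rev/ladder_step[]; rewrite rev_dartK => E6 N5 _; exact: order_face6.
move=> x; case: (Tall x) => e De [] ->; rewrite ?order_face_next; try exact: hex.
have [_ _ [D' E]] := ladder_step (ladder_rev De).
rewrite rev_dartK in D' E; have e4 := revR (esym De).
by rewrite -[R (L (L e))](rev_dartK) e4 -E order_face_next; exact: hex.
Qed.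

Lemma tube_rev d : tube d -> tube (rd d).
Proof.
move=> D; have e4 := revR (esym D); have e3 := revL (erefl (L (R (L d)))).
have e2 := revR (erefl (R (L d))); have e1 := revL (erefl (L d)).
by rewrite /tube -e4 -e3 -e2 -e1.
Qed.

Lemma tube_rot d : tube d -> tube (R (L d)).
Proof. by rewrite /tube => ->. Qed.

(* The faces of x and y lie to the right of the closed walk; each contains    *)
(* two consecutive edges of the walk, traversed backwards.                    *)
Lemma tube_faces d (x := rd d) (y := rd (R (L d))) : tube d ->
  [/\ L (L x) = R (R (L d)), L (L y) = R d,
      iter 5 L x = x -> iter 4 L x = rd (L (L y)) &
      iter 6 L x = x -> iter 5 L x = rd (L (L y))].
Proof.
rewrite {}/x {}/y => D; have e4 := revR (esym D).
have e3 := revL (erefl (L (R (L d)))).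
have e2 := revR (erefl (R (L d))).
have Ly : L (L (rd (R (L d)))) = R d by rewrite -e2 LrE.
split=> //; first by rewrite -e4 LrE.
  by move=> E; rewrite Ly; have := revL (esym E); rewrite rev_dartK => <-;
    rewrite rev_dartK.
by move=> E; rewrite Ly; have := revL (esym E); rewrite rev_dartK => <-; rewrite rev_dartK.
Qed.

(** The two faces on one side of the walk share both edges that leave it on that side. Unless both
    are hexagons, too little room is left between the far ends of these edges; if both are, their
    remaining edges form the next tube. *)
Lemma tube_step d : tube d -> [/\ order L (rd d) = 6, order L (rd (R (L d))) = 6 &
  tube (iter 3 L (rd (R (L d))))].
Proof.
(* A pentagon and a hexagon leave one edge and a path of two edges with the same ends, hence a face
   walk that closes after three steps. *)
have mixed e : tube e -> iter 5 L (rd e) = rd e ->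
    iter 6 L (rd (R (L e))) = rd (R (L e)) -> False.
  move=> De x5 y6; have [_ _ /(_ x5) X _] := tube_faces De.
  have [_ _ _ /(_ y6)] := tube_faces (tube_rot De).
  rewrite De; set x := rd e in X *; set y := rd (R (L e)) in X * => Y.
  have g1 : L (rd (iter 3 L y)) = rd (iter 3 L x).
    rewrite LrE; have -> : rd (iter 3 L x) = R (L (L y)).
      by rewrite (revL (erefl (iter 4 L x))) X rev_dartK.
    by [].
  have g2 : L (rd (iter 3 L x)) = rd (iter 4 L y).
    rewrite LrE; have -> : rd (iter 4 L y) = R (L (L x)).
      by rewrite (revL (erefl (iter 5 L y))) Y rev_dartK.
    by [].
  apply: (@src_iter_face (rd (iter 3 L y)) 3 isT).
  by rewrite !iterS g1 g2 srcL tgt_rev src_rev -srcL.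
(* Two pentagons each leave one edge with the same ends, hence the same edge, whose end would then
   have degree 2. *)
have both5 e : tube e -> iter 5 L (rd e) = rd e ->
    iter 5 L (rd (R (L e))) = rd (R (L e)) -> False.
  move=> De x5 y5; have [_ _ /(_ x5) X _] := tube_faces De.
  have [_ _ /(_ y5) Y _] := tube_faces (tube_rot De).
  rewrite De in Y; set x := rd e in X Y; set y := rd (R (L e)) in X Y.
  have E : iter 3 L y = rd (iter 3 L x).
    have Sx : src (iter 4 L x) = tgt (iter 3 L x) by exact: srcL.
    have Sy : src (iter 4 L y) = tgt (iter 3 L y) by exact: srcL.
    apply: dart_inj; first by rewrite src_rev -Sx X src_rev; exact: srcL.
    by rewrite tgt_rev -Sy Y src_rev; apply/esym; exact: srcL.
  have := RE (iter 3 L x); rewrite -[L _]/(iter 4 L x) X.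
  by rewrite -[LHS]/(iter 3 L y) E => /esym/(sigma2_neq cubicG rotG).
move=> D; have D3 := tube_rot D.
case: (face_cases (rd d)) => [x5|[x6 x5]];
  case: (face_cases (rd (R (L d)))) => [y5|[y6 y5]].
- by case: (both5 d).
- by case: (mixed d).
- by case: (mixed (R (L d))) => //; rewrite D.
split; [exact: order_face6|exact: order_face6|].
have [L2x _ _ /(_ x6) X] := tube_faces D.
have [_ _ _] := tube_faces D3; rewrite D => /(_ y6) Y.
rewrite /tube; set x := rd d in X Y *; set y := rd (R (L d)) in X Y *.
have g1 : R (iter 4 L y) = iter 3 L x.
  by rewrite -RE -iterS Y.
have g2 : R (iter 4 L x) = iter 3 L y.
  by rewrite -RE -iterS X.
by rewrite -iterS g1 -iterS g2.
Qed.

Lemma no_tube d : ~ tube d.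
Proof.
move=> D0; apply: not_all_hexagons.
(* The vertices on tubes are closed under adjacency, and the three faces around each of them are
   hexagons. *)
pose S v := exists2 d, tube d & src d = v.
have step e (De : tube e) :
    [/\ S (tgt e), S (tgt (sigma e)) & S (tgt (sigma (sigma e)))] /\
    [/\ order L e = 6, order L (sigma e) = 6 & order L (sigma (sigma e)) = 6].
  have e4 := revR (esym De).
  have [o1 o2 D'] := tube_step (tube_rev De); rewrite rev_dartK in o1.
  have [_ L2y _ _] := tube_faces (tube_rev De); rewrite RrE in L2y.
  split; split=> //.
  - by exists (rd e); first exact: tube_rev.
  - exists (rd (R (L e))); first exact/tube_rev/tube_rot.
    by rewrite -LrE -e4 src_rev tgt_rev srcL.
  - by exists (iter 3 L (rd (R (L (rd e))))) => //; rewrite iterS srcL -[in RHS]L2y.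
  - by rewrite -LrE order_face_next; have [] := tube_step De.
  - by rewrite -L2y !order_face_next.
have Sall : forall v, S v.
  apply: (@connect_darts G connG S (src d)); first by exists d.
  move=> e [e' De' /(sigma_orbit cubicG rotG)].
  by have [[? ? ?] _] := step e' De' => -[] ->.
move=> e; have [e' De' /(sigma_orbit cubicG rotG)] := Sall (src e).
by have [_ [? ? ?]] := step e' De' => -[] ->.
Qed.

(** Each corner of the 4-cycle is a left or a right turn. Three equal consecutive turns put all four
    edges on one face; up to rotation, only LLRR (a ladder) and LRLR (a tube) remain. *)
Lemma no_four_cycle (u a w b : G) :
  adj u a -> adj a w -> adj w b -> adj b u -> u != w -> a != b -> False.
Proof.
move=> ua aw wb bu uw ab.
pose d1 := mkdart ua; pose d2 := mkdart aw; pose d3 := mkdart wb; pose d4 := mkdart bu.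
have turn d d' : src d' = tgt d -> tgt d' != src d -> d' = L d \/ d' = R d.
  by move=> /(face_nextP cubicG rotG)[->|->|->]; [rewrite tgt_rev eqxx|left|right].
have t1 : d2 = L d1 \/ d2 = R d1 by apply: turn => //; rewrite eq_sym.
have t2 : d3 = L d2 \/ d3 = R d2 by apply: turn => //; rewrite eq_sym.
have t3 : d4 = L d3 \/ d4 = R d3 by apply: turn.
have t4 : d1 = L d4 \/ d1 = R d4 by apply: turn.
have noLLL c1 c2 c3 c4 : c2 = L c1 -> c3 = L c2 -> c4 = L c3 -> src c1 = tgt c4 -> False.
  move=> E2 E3 E4 E1; apply: (@src_iter_face c1 4 isT).
  by rewrite iterS /= -E2 -E3 -E4 srcL.
have noRRR c1 c2 c3 c4 : c2 = R c1 -> c3 = R c2 -> c4 = R c3 -> src c1 = tgt c4 -> False.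
  move=> /revR E2 /revR E3 /revR E4 E1; exact: (noLLL _ _ _ _ E4 E3 E2).
have noLLRR c1 c2 c3 c4 : c2 = L c1 -> c3 = L c2 -> c4 = R c3 -> c1 = R c4 -> False.
  by move=> E2 E3 E4 E1; apply: (@no_ladder c1); rewrite /ladder -E2 -E3 -E4 -E1.
have noLRLR c1 c2 c3 c4 : c2 = L c1 -> c3 = R c2 -> c4 = L c3 -> c1 = R c4 -> False.
  by move=> E2 E3 E4 E1; apply: (@no_tube c1); rewrite /tube -E2 -E3 -E4 -E1.
case: t1 t2 t3 t4 => [t1|t1] [t2|t2] [t3|t3] [t4|t4];
first [ exact: noLLL t1 t2 t3 _ | exact: noLLL t2 t3 t4 _
      | exact: noLLL t3 t4 t1 _ | exact: noLLL t4 t1 t2 _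
      | exact: noRRR t1 t2 t3 _ | exact: noRRR t2 t3 t4 _
      | exact: noRRR t3 t4 t1 _ | exact: noRRR t4 t1 t2 _
      | exact: noLLRR t1 t2 t3 t4 | exact: noLLRR t2 t3 t4 t1
      | exact: noLLRR t3 t4 t1 t2 | exact: noLLRR t4 t1 t2 t3
      | exact: noLRLR t1 t2 t3 t4 | exact: noLRLR t2 t3 t4 t1 ].
Qed.

End FourCycles.

(** * Homology of the sphere over F_2 *)

Section PermOrbits.
Variables (T : finType) (p : {perm T}).

Lemma fconnect_porbit x y : fconnect p x y = (y \in porbit p x).
Proof.
apply/idP/porbitP => [xy|[i ->]]; last by rewrite permX fconnect_iter.
by exists (findex p x y); rewrite permX iter_findex.
Qed.

Lemma card_porbits : #|porbits p| = fcard p T.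
Proof.
rewrite /n_comp_mem; set r := predI _ _.
have -> : porbits p = [set porbit p x | x in r].
  apply/setP=> O; apply/imsetP/imsetP => [[x _ ->]|[x _ ->]]; last by exists x.
  exists (fingraph.root (frel p) x); first by rewrite inE /= roots_root //;
    exact/fconnect_sym/perm_inj.
  by apply/eqP; rewrite eq_porbit_mem porbit_sym -fconnect_porbit connect_root.
rewrite card_in_imset // => x y /andP[/eqP rx _] /andP[/eqP ry _] /eqP.
rewrite eq_porbit_mem -fconnect_porbit => xy.
have sym := fconnect_sym (@perm_inj _ p).
by rewrite -rx -ry; apply/(fingraph.rootP sym); rewrite sym.
Qed.

End PermOrbits.

Section ExactRank.
Local Open Scope ring_scope.
Variable F : fieldType.

Lemma mxrank_const_ker m p (A : 'M[F]_(m, p)) :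
  (forall u : 'rV_m, u *m A = 0 -> forall i j, u 0 i = u 0 j) -> (m <= \rank A + 1)%N.
Proof.
move=> H; suff : (\rank (kermx A) <= 1)%N by rewrite mxrank_ker; lia.
have : (kermx A <= (const_mx 1 : 'rV_m))%MS.
  apply/row_subP=> i; have /sub_kermxP/H ui := row_sub i (kermx A).
  case: m A H i ui => [|m] A H i ui; first by have := ltn_ord i.
  apply/sub_rVP; exists (row i (kermx A) 0 0); apply/rowP=> j.
  by rewrite [RHS]mxE [const_mx _ _ _]mxE mulr1; exact: ui.
by move/mxrankS/leq_trans; apply; exact: rank_leq_row.
Qed.

(** The row space of [A] lies in the kernel of [B]; the rank hypothesis makes the two dimensions
    agree. *)
Lemma exact_of_rank m p q (A : 'M[F]_(m, p)) (B : 'M_(p, q)) (y : 'rV_p) :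
  A *m B = 0 -> (p <= \rank A + \rank B)%N -> y *m B = 0 -> (y <= A)%MS.
Proof.
move=> AB rAB yB; have AK : (A <= kermx B)%MS by exact/sub_kermxP.
have yK : (y <= kermx B)%MS by exact/sub_kermxP.
apply: submx_trans yK _; have [_ <-] := mxrank_leqif_sup AK.
by rewrite eqn_leq mxrankS //= mxrank_ker; lia.
Qed.

End ExactRank.

Lemma F2_natr (b : bool) : ((b%:R : 'F_2) != 0 :> 'F_2)%R = b.
Proof. by case: b. Qed.

Lemma F2_boolE (x : 'F_2) : x = ((x != 0)%R%:R)%R.
Proof. by case: x => -[|[|[]]] // i; apply: val_inj. Qed.

Lemma F2_addbE (b c : bool) : (b%:R + c%:R = (b (+) c)%:R :> 'F_2)%R.
Proof. by case: b; case: c; apply: val_inj. Qed.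

Lemma F2_oddE (n : nat) : (n%:R = (odd n)%:R :> 'F_2)%R.
Proof.
by elim: n => // n IH; rewrite -natr1 IH /= -[(1)%R]/(true%:R)%R F2_addbE addbT.
Qed.

Lemma F2_addxx (x : 'F_2) : (x + x = 0)%R.
Proof. by case: x => -[|[|[]]] // i; apply: val_inj. Qed.

Section Homology.
Variables (G : sgraph) (sigma : {perm dart G}).
Hypotheses (cubicG : cubic G) (rotG : rotation sigma).
Hypothesis connG : forall x y : G, connect (@adj G) x y.
Hypothesis eulerG : #|G| + nb_faces sigma = #|edges G| + 2.
Implicit Types d : dart G.

Local Notation L := (face_next sigma).
Local Notation rd := (@rev_dart G).

Definition face_perm : {perm dart G} := perm (@face_next_inj _ sigma).

Lemma face_permE d : face_perm d = L d. Proof. exact: permE. Qed.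

Lemma card_faces : #|porbits face_perm| = nb_faces sigma.
Proof.
rewrite card_porbits /nb_faces; apply: eq_n_comp => x y; apply: eq_connect => u v /=.
by rewrite face_permE.
Qed.

Local Open Scope ring_scope.

Let mem_porbits d : porbit face_perm d \in porbits face_perm.
Proof. exact: imset_f. Qed.

Let nf := #|porbits face_perm|.
Let ne := #|edges G|.
Let nv := #|G|.

Let fi d : 'I_nf := enum_rank_in (mem_porbits d) (porbit face_perm d).
Let ei d : 'I_ne := enum_rank_in (edge_set_in d) (edge_set d).
Let vi d : 'I_nv := enum_rank (src d).

Let fiE d : enum_val (fi d) = porbit face_perm d.
Proof. by rewrite enum_rankK_in // mem_porbits. Qed.

Let eiE d : enum_val (ei d) = edge_set d.
Proof. by rewrite enum_rankK_in // edge_set_in. Qed.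

Let fi_eq d d' : (fi d == fi d') = (d \in porbit face_perm d').
Proof. by rewrite -eq_porbit_mem -!fiE (inj_eq enum_val_inj). Qed.

Let fiL d : fi (L d) = fi d.
Proof. by apply/eqP; rewrite fi_eq -face_permE (mem_porbit face_perm 1 d). Qed.

Let ei_eq d d' : (ei d' == ei d) = (d' == d) || (d' == rd d).
Proof. by rewrite -eq_edge_set -!eiE (inj_eq enum_val_inj). Qed.

Let fi_onto i : exists d, fi d = i.
Proof.
have /imsetP[d _ E] := enum_valP i.
by exists d; apply: enum_val_inj; rewrite fiE.
Qed.

Let ei_onto j : exists d, ei d == j.
Proof.
have := enum_valP j; rewrite inE => /existsP[x /existsP[y /andP[xy /eqP E]]].
by exists (mkdart xy); apply/eqP/enum_val_inj; rewrite eiE E.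
Qed.

Let sum_edge (g : dart G -> 'F_2) d : \sum_(d' | ei d' == ei d) g d' = g d + g (rd d).
Proof.
rewrite (bigD1 d) //= (bigD1 (rd d)) /=; last first.
  by rewrite ei_eq eqxx orbT rev_dart_neq.
rewrite big1 ?addr0 // => d' /andP[/andP[]]; rewrite ei_eq => /orP[]/eqP->; by rewrite eqxx.
Qed.

(** The cellular boundary maps over F_2, acting on row vectors. Summing over both darts of an edge
    makes an edge with the same face on both sides contribute 0. *)
Let bd2 : 'M['F_2]_(nf, ne) := \matrix_(i, j) \sum_(d | ei d == j) (fi d == i)%:R.
Let bd1 : 'M['F_2]_(ne, nv) := \matrix_(j, v) \sum_(d | ei d == j) (vi d == v)%:R.

Let mul_bd2 (u : 'rV_nf) d : (u *m bd2) 0 (ei d) = u 0 (fi d) + u 0 (fi (rd d)).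
Proof.
rewrite mxE -(sum_edge (fun d => u 0 (fi d))).
under eq_bigr do rewrite mxE mulr_sumr.
rewrite exchange_big /=; apply: eq_bigr => d' _.
rewrite (bigD1 (fi d')) //= eqxx mulr1 big1 ?addr0 // => i /negPf.
by rewrite eq_sym => ->; rewrite mulr0.
Qed.

Let mul_bd1 (w : 'rV_nv) d : (w *m bd1^T) 0 (ei d) = w 0 (vi d) + w 0 (vi (rd d)).
Proof.
rewrite mxE -(sum_edge (fun d => w 0 (vi d))).
under eq_bigr do rewrite !mxE mulr_sumr.
rewrite exchange_big /=; apply: eq_bigr => d' _.
rewrite (bigD1 (vi d')) //= eqxx mulr1 big1 ?addr0 // => i /negPf.
by rewrite eq_sym => ->; rewrite mulr0.
Qed.

Let bdE (y : 'rV_ne) v : (y *m bd1) 0 v = \sum_(d | vi d == v) y 0 (ei d).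
Proof.
rewrite mxE; under eq_bigr do rewrite mxE mulr_sumr.
rewrite (exchange_big_dep predT) //= [RHS]big_mkcond; apply: eq_bigr => d _.
rewrite (big_pred1 (ei d)) => [|j]; last by rewrite /= eq_sym.
by case: (_ == _); rewrite ?mulr1 ?mulr0.
Qed.

Let cobdE (x : 'rV_ne) i : (x *m bd2^T) 0 i = \sum_(d | fi d == i) x 0 (ei d).
Proof.
rewrite mxE; under eq_bigr do rewrite !mxE mulr_sumr.
rewrite (exchange_big_dep predT) //= [RHS]big_mkcond; apply: eq_bigr => d _.
rewrite (big_pred1 (ei d)) => [|j]; last by rewrite /= eq_sym.
by case: (_ == _); rewrite ?mulr1 ?mulr0.
Qed.

Let row_eq m (u w : 'rV['F_2]_m) : (forall j, u 0 j = w 0 j) -> u = w.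
Proof. by move=> H; apply/rowP. Qed.

Let add0_F2 (x y : 'F_2) : x + y = 0 -> x = y.
Proof. by move=> E; rewrite -[x]addr0 -(F2_addxx y) addrA E add0r. Qed.

Let rank_bd2 : (nf <= \rank bd2 + 1)%N.
Proof.
apply: mxrank_const_ker => u ub i j.
have [d <-] := fi_onto i; have [d' <-] := fi_onto j.
apply/esym; move: d'; apply: (dart_connected cubicG rotG connG (d0 := d)) => // d' <-.
  by rewrite fiL.
apply/esym/add0_F2; rewrite -mul_bd2 ub mxE //.
Qed.

Let rank_bd1 : (nv <= \rank bd1 + 1)%N.
Proof.
rewrite -mxrank_tr; apply: mxrank_const_ker => w wb i j.
rewrite -(enum_valK i) -(enum_valK j); apply/esym; move: (enum_val j).
apply: (connect_darts connG (v0 := enum_val i)) => // d <-.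
by apply/esym/add0_F2; rewrite -[src d]/(src d) -mul_bd1 wb mxE.
Qed.

Let bd21 : bd2 *m bd1 = 0.
Proof.
apply/row_matrixP=> i; rewrite row_mul row0; apply: row_eq => v.
rewrite bdE [RHS]mxE.
have E d : row i bd2 0 (ei d) = (fi d == i)%:R + (fi (rd d) == i)%:R.
  by rewrite !mxE (sum_edge (fun d => (fi d == i)%:R)).
under eq_bigr do rewrite E.
rewrite big_split /= [X in _ + X](_ : _ = \sum_(d | vi d == v) (fi d == i)%:R) ?F2_addxx //.
rewrite [LHS]big_mkcond [RHS]big_mkcond /= (reindex_inj (@rev_dart_inj G)) /=.
rewrite [RHS](reindex_inj (@face_next_inj _ sigma)) /=; apply: eq_bigr => d _.
by rewrite rev_dartK fiL /vi src_face_next.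
Qed.

(** Vanishing first homology: connectedness gives ranks at least F - 1 and V - 1 for the two
    boundary maps, and Euler's formula says that these add up to E. The set [a] of faces has
    boundary [y]. *)
Lemma even_boundary (y : dart G -> bool) : (forall d, y (rd d) = y d) ->
  (forall v, ~~ odd #|[set d | (src d == v) && y d]|) ->
  exists2 a : dart G -> bool, forall d, a (L d) = a d & forall d, y d = a d (+) a (rd d).
Proof.
move=> yr yev.
pose Y : 'rV['F_2]_ne := \row_j (y (xchoose (ei_onto j)))%:R.
have YE d : Y 0 (ei d) = (y d)%:R.
  rewrite mxE; have := xchooseP (ei_onto (ei d)); rewrite ei_eq.
  by case/orP => /eqP ->; rewrite ?yr.
have /submxP[u Yu] : (Y <= bd2)%MS.
  apply: exact_of_rank bd21 _ _.
    by move: rank_bd2 rank_bd1 eulerG; rewrite -card_faces -/nf -/ne -/nv; lia.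
  apply: row_eq => v; rewrite bdE mxE; under eq_bigr do rewrite YE.
  rewrite -natr_sum F2_oddE -big_mkcondr sum1_card /=.
  rewrite (_ : odd _ = false) //; apply/negbTE.
  have := yev (enum_val v); rewrite cardsE; congr (~~ odd _); apply: eq_card => d.
  by rewrite !unfold_in /= /vi (can2_eq enum_rankK enum_valK).
exists (fun d => u 0 (fi d) != 0) => d; first by rewrite fiL.
have := YE d; rewrite Yu mul_bd2 [u 0 (fi d)]F2_boolE [u 0 (fi (rd d))]F2_boolE F2_addbE.
by move/(congr1 (fun x => x != 0)); rewrite !F2_natr.
Qed.

(** Start from an arbitrary orientation [o] and flip a set [x] of edges to repair the parity of
    every face. The required corrections [c] form a coboundary exactly when their total is 0, and
    this total is F + E = 2E + 2 - V, which is even since V is. *)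
Lemma odd_face_orientation : exists2 s : dart G -> bool,
  forall d, s (rd d) = ~~ s d &
  forall d, odd #|[set d' in porbit face_perm d | s d']|.
Proof.
pose o d := (enum_rank (src d) < enum_rank (tgt d))%N.
have orv d : o (rd d) = ~~ o d.
  rewrite /o -leqNgt src_rev tgt_rev ltn_neqAle andbC; case: leqP => //= _.
  by rewrite (inj_eq val_inj) (inj_eq enum_rank_inj) eq_sym src_neq_tgt.
have even_n : ~~ odd nv.
  by have := card_darts cubicG; have := @card_edges G; rewrite -/nv; lia.
have o_ne : #|o| = ne.
  have := @card_edges G; rewrite -(cardC o) -/ne.
  rewrite [X in (_ + X)%N](_ : _ = #|o|); last first.
    rewrite -(card_image (@rev_dart_inj G)); apply: eq_card => d.
    have oE z : (z \in o) = o z by [].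
    apply/imageP/idP => [[d' od' ->]|od].
      by move: od'; rewrite oE orv inE oE.
    by exists (rd d); rewrite ?rev_dartK // inE oE orv negbK.
  by rewrite addnn -mul2n => /eqP; rewrite eqn_pmul2l // => /eqP.
pose c : 'rV['F_2]_nf := \row_i (1 + \sum_(d | fi d == i) (o d)%:R).
have /submxP[x cx] : (c <= bd2^T)%MS.
  (* The all-ones column is the map summing over faces; its rank 1 complements the rank F - 1 of the
     coboundary. *)
  apply: (exact_of_rank (B := const_mx 1 : 'M_(nf, 1))).
  - apply/matrixP=> j k; have [d /eqP <-] := ei_onto j; rewrite !mxE.
    under eq_bigr do rewrite !mxE mulr1.
    rewrite exchange_big /= (sum_edge (fun d => \sum_i (fi d == i)%:R)).
    have S1 d' : \sum_i (fi d' == i)%:R = 1 :> 'F_2.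
      rewrite (bigD1 (fi d')) //= eqxx big1 ?addr0 // => i /negPf.
      by rewrite eq_sym => ->.
    by rewrite !S1 F2_addxx.
  - rewrite mxrank_tr; have r1 := rank_bd2.
    have [nf0|nf0] := posnP nf; first by rewrite [X in (X <= _)%N]nf0.
    apply: leq_trans r1 _; rewrite leq_add2l.
    rewrite lt0n mxrank_eq0; apply/eqP=> /matrixP/(_ (Ordinal nf0) 0).
    by rewrite !mxE => /eqP; rewrite oner_eq0.
  - apply/matrixP=> k1 k2; rewrite !mxE.
    under eq_bigr do rewrite !mxE mulr1.
    rewrite big_split /= sumr_const card_ord (exchange_big_dep predT) //=.
    have oS d : \sum_(i < nf | fi d == i) (o d)%:R = (o d)%:R :> 'F_2.
      by rewrite (big_pred1 (fi d)) // => i /=; rewrite eq_sym.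
    under eq_bigr do rewrite oS.
    rewrite -natr_sum -natrD F2_oddE -big_mkcond sum1_card o_ne.
    by move: eulerG even_n; rewrite -card_faces -/nf -/ne -/nv => eu /negPf ev;
      rewrite (_ : odd _ = false) //; lia.
exists (fun d => (x 0 (ei d) != 0) (+) o d) => d.
  by rewrite orv addbN; congr (~~ (_ (+) _));
    have /eqP -> : ei (rd d) == ei d by rewrite ei_eq eqxx orbT.
have := congr1 (fun r : 'rV_nf => r 0 (fi d)) cx; rewrite cobdE mxE => /esym.
move/(congr1 (fun z => z + \sum_(d' | fi d' == fi d) (o d')%:R)).
rewrite -addrA F2_addxx addr0 -big_split /=.
under eq_bigr do rewrite [x 0 _]F2_boolE F2_addbE.
rewrite -natr_sum F2_oddE -big_mkcondr sum1_card /= => /(congr1 (fun z => z != 0)).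
rewrite F2_natr oner_eq0 => H; rewrite cardsE; move: H; congr (odd _ = true).
by apply: eq_card => d'; rewrite !unfold_in /= fi_eq.
Qed.

End Homology.

(** * Signs of even cycles *)

Lemma odd_sum (I : finType) (A : {set I}) (F : I -> nat) :
  odd (\sum_(i in A) F i) = \big[addb/false]_(i in A) odd (F i).
Proof. exact: (big_morph odd oddD). Qed.

Lemma odd_sum_odd (I : finType) (A : {set I}) (F : I -> nat) :
  (forall i, i \in A -> odd (F i)) -> odd (\sum_(i in A) F i) = odd #|A|.
Proof.
move=> oF; rewrite -sum1_card !odd_sum; by apply: eq_bigr => i /oF ->.
Qed.

Lemma porbit2 (T : finType) (p : {perm T}) x : p (p x) = x ->
  porbit p x = [set x; p x].
Proof.
move=> pK; apply/setP=> y; rewrite !inE; apply/porbitP/orP => [[i ->]|[]/eqP->].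
- rewrite permX; elim: i => [|i] /=; first by left.
  by case=> /eqP ->; [right|left]; rewrite ?pK.
- by exists 0; rewrite perm1.
- by exists 1.
Qed.

Lemma card_marked2 (T : finType) (s : pred T) x y : x != y -> s y = ~~ s x ->
  #|[set z in [set x; y] | s z]| = 1.
Proof.
move=> nxy sy; have -> : [set z in [set x; y] | s z] = [set (if s x then x else y)].
  apply/setP=> z; rewrite !inE; case: eqP => [->|nx] /=.
    by case: ifP => sx; rewrite ?eqxx // (negPf nxy).
  case: eqP => [->|ny] /=; first by rewrite sy; case: ifP;
    rewrite ?eqxx // eq_sym (negPf nxy).
  by case: ifP => _; apply/esym/negbTE/eqP.
by rewrite cards1.
Qed.

Section PermParity.
Variables (T : finType) (p : {perm T}).
Implicit Types (A O : {set T}) (s : pred T).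

Lemma porbit_stable A x y : (forall z, (p z \in A) = (z \in A)) ->
  y \in porbit p x -> (y \in A) = (x \in A).
Proof.
move=> stA /porbitP[i ->]; rewrite permX.
by elim: i => //= i <-; rewrite stA.
Qed.

Lemma card_stable A s : (forall z, (p z \in A) = (z \in A)) ->
  #|[set x in A | s x]| =
  \sum_(O in [set O in porbits p | O \subset A]) #|[set x in O | s x]|.
Proof.
move=> stA; rewrite -sum1_card (partition_big (porbit p) (mem [set O in porbits p | O
  \subset A])).
  apply: eq_bigr => O /setIdP[/imsetP[x0 _ ->] sub].
  rewrite sum1_card; apply: eq_card => x; rewrite unfold_in /= !inE eq_porbit_mem.
  case: (boolP (x \in porbit p x0)) => xx0; rewrite ?andbT ?andbF //.
  by rewrite (subsetP sub _ xx0).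
move=> x /setIdP[xA _]; apply/setIdP; rewrite imset_f //; split=> //.
by apply/subsetP=> y /(porbit_stable stA) ->.
Qed.

(* A restriction of p to a stable set has |A| minus the number of orbits in A *)
(* as parity, and s marks an odd number of points on each of these orbits.    *)
Lemma odd_perm_marked (q : {perm T}) A s :
  (forall z, (p z \in A) = (z \in A)) ->
  (forall x, q x = if x \in A then p x else x) ->
  (forall x, x \in A -> odd #|[set y in porbit p x | s y]|) ->
  odd_perm q = odd #|A| (+) odd #|[set x in A | s x]|.
Proof.
move=> stA qE sodd; rewrite card_stable // odd_sum_odd; last first.
  move=> O; rewrite inE => /andP[/imsetP[x _ ->] sub]; apply: sodd.
  by apply: (subsetP sub); exact: porbit_id.
have qi x i : x \in A -> (q ^+ i)%g x = (p ^+ i)%g x.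
  move=> xA; rewrite !permX; elim: i => //= i ->; rewrite qE.
  by rewrite -permX (porbit_stable stA (mem_porbit p i x)) xA.
have qo x : x \in A -> porbit q x = porbit p x.
  move=> xA; apply/setP=> y; apply/porbitP/porbitP => -[i ->]; exists i;
  by rewrite qi.
have qn x : x \notin A -> porbit q x = [set x].
  move=> xA; apply/setP=> y; rewrite inE; apply/porbitP/eqP => [[i ->]|->];
    last by exists 0; rewrite perm1.
  by rewrite permX_fix // qE (negPf xA).
have -> : odd_perm q = odd #|T| (+) odd #|porbits q| by [].
have -> : porbits q = [set O in porbits p | O \subset A] :|: [set [set x] | x in ~: A].
  apply/setP=> O; rewrite !inE;
    apply/imsetP/orP => [[x _ ->]|[/andP[/imsetP[x _ ->] sub]|/imsetP[x]]].
  - have [xA|xA] := boolP (x \in A); [left|right]; last by rewrite qn // imset_f // inE.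
    rewrite qo // imset_f //=; apply/subsetP=> y /(porbit_stable stA) -> //.
  - by exists x => //; rewrite qo // (subsetP sub) // porbit_id.
  - by rewrite inE => xA ->; exists x => //; rewrite qn.
rewrite cardsU (_ : _ :&: _ = set0); last first.
  apply/setP=> O; rewrite !inE; apply/negbTE/negP=> /andP[/andP[_ sub] /imsetP[x]].
  by rewrite inE => /negP xA OE; apply: xA; apply: (subsetP sub); rewrite OE set11.
rewrite cards0 subn0 (card_imset _ set1_inj) oddD -(cardsC A) oddD.
by case: (odd _); case: (odd _); case: (odd _).
Qed.

Lemma even_stable A : (forall z, (p z \in A) = (z \in A)) ->
  (forall x, x \in A -> ~~ odd #|porbit p x|) -> ~~ odd #|A|.
Proof.
move=> stA ev; have := card_stable xpredT stA.
have -> : [set x in A | xpredT x] = A by apply/setP=> x; rewrite inE andbT.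
move=> ->; rewrite odd_sum big1 // => O; rewrite inE => /andP[/imsetP[x _ ->] sub].
have -> : [set x0 in porbit p x | xpredT x0] = porbit p x by apply/setP=> y;
  rewrite inE andbT.
by apply/negbTE/ev/(subsetP sub)/porbit_id.
Qed.

End PermParity.

Section CycleSign.
Variables (G : sgraph) (sigma : {perm dart G}).
Hypotheses (cubicG : cubic G) (rotG : rotation sigma).
Hypothesis connG : forall x y : G, connect (@adj G) x y.
Hypothesis eulerG : #|G| + nb_faces sigma = #|edges G| + 2.
Variable s : dart G -> bool.
Hypothesis srev : forall d, s (rev_dart d) = ~~ s d.
Hypothesis sodd : forall d, odd #|[set d' in porbit (face_perm sigma) d | s d']|.
Variable pi : {perm G}.
Hypothesis piadj : forall v, adj v (pi v).
Hypothesis pieven : forall v, ~~ odd #|porbit pi v|.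
Implicit Types d : dart G.

Local Notation L := (face_next sigma).
Local Notation R := (right_next sigma).
Local Notation rd := (@rev_dart G).
Local Notation fp := (face_perm sigma).

Definition perm_dart v : dart G := mkdart (piadj v).

Let src_pd v : src (perm_dart v) = v. Proof. by []. Qed.
Let tgt_pd v : tgt (perm_dart v) = pi v. Proof. by []. Qed.

Let perm_dartP d : (d == perm_dart (src d)) = (tgt d == pi (src d)).
Proof.
apply/eqP/eqP => [->//|E]; exact: dart_inj.
Qed.

Lemma odd_2cycle v : pi (pi v) = v -> odd #|[set w in porbit pi v | s (perm_dart w)]|.
Proof.
move=> piv; rewrite (porbit2 piv) card_marked2 //.
  exact: src_neq_tgt (perm_dart v).
by rewrite -srev; congr s; apply: dart_inj => //; rewrite tgt_pd piv.
Qed.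

Section LongCycle.
Variable v0 : G.
Hypothesis long0 : pi (pi v0) <> v0.
Local Notation O := (porbit pi v0).

Let Opi v : (pi v \in O) = (v \in O).
Proof. by rewrite -!eq_porbit_mem (porbit_perm pi 1 v). Qed.

Let long v : v \in O -> pi (pi v) != v.
Proof.
move=> /porbitP[i ->]; apply/eqP=> E; apply: long0; apply: (@perm_inj _ (pi ^+ i)%g).
by move: E; rewrite !permX => <-; rewrite -!iterSr !iterS.
Qed.

Let C d := (src d \in O) && (tgt d == pi (src d)).
Let y d := C d || C (rd d).

Let CE d : C d -> d = perm_dart (src d).
Proof. by case/andP=> _; rewrite -perm_dartP => /eqP. Qed.

Let y_out d : src d \notin O -> y d = false.
Proof.
move=> n; rewrite /y /C (negPf n) /= src_rev tgt_rev; apply/negbTE/negP=> /andP[tO /eqP E].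
by rewrite E Opi tO in n.
Qed.

Let y_in w : w \in O -> [set d | (src d == w) && y d] =
  [set perm_dart w; rd (perm_dart (pi^-1%g w))].
Proof.
move=> wO; apply/setP=> d; rewrite !inE; apply/idP/orP => [/andP[/eqP sd]|[]/eqP->].
- case/orP=> /CE E; [left|right]; first by rewrite E sd.
  rewrite -(rev_dartK d) E; apply/eqP; congr (rd (perm_dart _)).
  move: (E) => /(congr1 (@tgt G)); rewrite tgt_rev tgt_pd sd => ->.
  by rewrite permK.
- by rewrite src_pd eqxx /y /C src_pd wO tgt_pd eqxx.
- have wO' : pi^-1%g w \in O by rewrite -Opi permKV.
  by rewrite src_rev tgt_pd permKV eqxx /y orbC /C rev_dartK src_pd tgt_pd wO' eqxx.
Qed.

Let y_even v : ~~ odd #|[set d | (src d == v) && y d]|.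
Proof.
have [vO|vO] := boolP (v \in O).
  rewrite y_in // cards2 (_ : _ != _) //; apply/eqP=> /(congr1 (@tgt G)).
  rewrite tgt_pd tgt_rev src_pd => E; have := long vO; rewrite E permKV => /eqP; apply.
  done.
have -> : [set d | (src d == v) && y d] = set0; last by rewrite cards0.
by apply/setP=> d; rewrite !inE; case: eqP => //= E; rewrite y_out // E.
Qed.

(** The edges of the cycle bound a set of faces, determined here up to complement. Membership of the
    left face propagates along the cycle: at a right turn, the edge crossed on the left is not on
    the cycle. *)
Lemma region_left_of_cycle : exists2 a : dart G -> bool,
  (forall d, a (L d) = a d) /\ (forall d, y d = a d (+) a (rd d)) &
  forall v, v \in O -> a (perm_dart v).
Proof.
have yr d : y (rd d) = y d by rewrite /y rev_dartK orbC.
have [a0 a0L a0y] := even_boundary cubicG rotG connG eulerG yr y_even.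
(* Complement the region if needed, so that it contains the face to the left of the dart at [v0]. *)
pose a d := a0 d (+) ~~ a0 (perm_dart v0).
have aL d : a (L d) = a d by rewrite /a a0L.
have ay d : y d = a d (+) a (rd d).
  by rewrite /a a0y; case: (a0 d); case: (a0 (rd d)); case: (a0 _).
exists a => // v /porbitP[i ->]; rewrite permX.
have : iter i pi v0 \in O by rewrite -permX mem_porbit.
elim: i => [|i IH]; first by rewrite /a addbN addbb.
rewrite iterS Opi; set w := iter i pi v0 in IH * => wO.
have := IH wO; set c := perm_dart w => ac.
have : src (perm_dart (pi w)) = tgt c by [].
case/(face_nextP cubicG rotG) => E.
- have := long wO; rewrite -[pi (pi w)]/(tgt (perm_dart (pi w))) E tgt_rev eqxx //.
- by rewrite E aL.
- rewrite E -sigma_face_next -face_next_rev aL.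
  have := ay (L c); rewrite aL ac.
  suff -> : y (L c) = false by case: (a _).
  have : L c \notin [set d | (src d == pi w) && y d].
    rewrite y_in ?Opi // permK !inE E; apply/norP; split; apply/eqP.
      by rewrite -sigma_face_next => /esym/(sigma_neq cubicG rotG).
    exact: (sigma_neq cubicG rotG).
  by rewrite inE src_face_next // tgt_pd eqxx => /negbTE.
Qed.

(* Let n, e and f be the numbers of vertices, edges and faces inside the      *)
(* region. The cycles of psi are the n orbits of sigma inside it and one      *)
(* cycle along its boundary, so comparing signs shows that f + e + n is odd;  *)
(* and n is even, because pi acts on the vertices inside.                     *)
Lemma odd_long_cycle : odd #|[set w in O | s (perm_dart w)]|.
Proof.
have [a [aL ay] aO] := region_left_of_cycle.
have aOr v : v \in O -> a (rd (perm_dart v)) = false.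
  move=> vO; have := ay (perm_dart v); rewrite aO // /y /C src_pd tgt_pd vO eqxx.
  by case: (a (rd _)).
have a_out d : src d \notin O -> a (rd d) = a d.
  by move=> /y_out; rewrite ay; case: (a d); case: (a _).
have a_C d : a d -> ~~ a (rd d) -> C d.
  move=> ad /negbTE nd; have := ay d; rewrite ad nd /= => /orP[//|Crd].
  have E := CE Crd; have := aO (src (rd d)); rewrite -E nd.
  by case/andP: Crd => sO _ /(_ sO).
have a_int d : src d \in O -> a d -> d != perm_dart (src d) -> a (rd d).
  move=> sO ad nd; apply: contraNT nd => /(a_C _ ad)/CE E; exact/eqP.
pose A := [set d | a d]; pose I := [set d | a d && a (rd d)].
pose Cs := [set d | C d].
have alI : injective (fun d => if d \in I then rd d else d).
  apply: inv_inj => d /=; have [dI|/negPf dI] := boolP (d \in I); last by rewrite dI.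
  by rewrite (_ : rd d \in I) ?rev_dartK //; move: dI; rewrite !inE rev_dartK andbC.
have phI : injective (fun d => if d \in A then L d else d).
  move=> d d'; rewrite !inE; case: ifP => ad; case: ifP => ad' // E.
  - exact: face_next_inj E.
  - by rewrite -E aL ad in ad'.
  - by rewrite E aL ad' in ad.
(* [alp] reverses the darts of interior edges and [phi] walks around the faces of the region. Hence
   [psi] acts as [sigma] on interior darts and as [L] on the boundary darts, and its sign can be
   computed from the factors or from its own orbits. *)
pose alp := perm alI; pose phi := perm phI; pose psi := (alp * phi)%g.
pose rp := perm (@rev_dart_inj G).
have rpE d : rp d = rd d by rewrite permE.
have fpE d : fp d = L d by exact: face_permE.
have porb_rp d : porbit rp d = [set d; rd d].
  by rewrite porbit2 !rpE ?rev_dartK.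
have odd_phi : odd_perm phi = odd #|A| (+) odd #|[set d in A | s d]|.
  by apply: (odd_perm_marked (p := fp)) => [d|d|d _]; rewrite ?permE ?inE ?fpE ?aL.
have even_I : ~~ odd #|I|.
  apply: (@even_stable _ rp) => [d|d _]; first by rewrite !inE rpE rev_dartK andbC.
  by rewrite porb_rp cards2 eq_sym rev_dart_neq.
have odd_alp : odd_perm alp = odd #|[set d in I | s d]|.
  rewrite -[RHS]addFb -(negbTE even_I).
  apply: (odd_perm_marked (p := rp)) => [d|d|d _].
  - by rewrite !inE rpE rev_dartK andbC.
  - by rewrite permE rpE.
  - by rewrite porb_rp card_marked2 // eq_sym rev_dart_neq.
have AIC : A = I :|: Cs.
  apply/setP=> d; rewrite !inE; case: (boolP (a d)) => ad /=.
    by case: (boolP (a (rd d))) => //= /(a_C _ ad) ->.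
  by apply/esym/negbTE; apply: contra ad => Cd; rewrite (CE Cd) aO //; case/andP: Cd.
have IC0 : I :&: Cs = set0.
  apply/setP=> d; rewrite !inE; apply/negbTE/negP=> /andP[/andP[_ ard] Cd].
  by move: ard; rewrite (CE Cd) aOr //; case/andP: Cd.
have Cs_im (P : pred (dart G)) : #|[set d in Cs | P d]| = #|[set v in O | P (perm_dart v)]|.
  have <- : perm_dart @: [set v in O | P (perm_dart v)] = [set d in Cs | P d].
    apply/setP=> d; rewrite !inE; apply/imsetP/andP => [[v]|[Cd Pd]].
      by rewrite inE => /andP[vO Pv] ->; rewrite /C src_pd tgt_pd vO eqxx.
    exists (src d); last exact: CE.
    by rewrite inE -(CE Cd) Pd andbT; case/andP: Cd.
  by rewrite card_in_imset // => v w _ _ /(congr1 (@src G)).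
have card_C : #|Cs| = #|O|.
  have := Cs_im xpredT; rewrite (_ : [set d in Cs | _] = Cs) => [->|];
    last by apply/setP=> d; rewrite inE andbT.
  by congr #|pred_of_set _|; apply/setP=> v; rewrite inE andbT.
have even_A : ~~ odd #|A|.
  by rewrite AIC cardsU IC0 cards0 subn0 oddD card_C (negbTE even_I) (negbTE (pieven v0)).
have -> : odd #|[set w in O | s (perm_dart w)]| = odd_perm psi.
  rewrite odd_permM odd_alp odd_phi (negbTE even_A) addFb -(Cs_im s).
  have -> : [set d in A | s d] = [set d in I | s d] :|: [set d in Cs | s d].
    by apply/setP=> d; rewrite AIC !inE andb_orl.
  rewrite cardsU (_ : _ :&: _ = set0) ?cards0 ?subn0 ?oddD ?addKb //.
  apply/setP=> d; have /setP/(_ d) := IC0; rewrite !inE.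
  by case: (C d); rewrite ?andbF ?andbT // => ->.
have psiE d : psi d = if a d then (if a (rd d) then sigma d else L d) else d.
  rewrite permM [alp d]permE permE !inE; case: (boolP (a d)) => ad /=;
    last by rewrite (negbTE ad).
  case: (boolP (a (rd d))) => ard; rewrite ?ard ?ad //.
  by rewrite face_next_rev.
have psi_src d : (src (psi d) \in O) = (src d \in O).
  rewrite psiE; case: (boolP (a d)) => ad //; case: ifP => ard; first by rewrite src_sigma.
  by have /andP[sO /eqP tE] := a_C _ ad (negbT ard); rewrite src_face_next // tE Opi sO.
have psi_a d : a (psi d) = a d.
  rewrite psiE; case: (boolP (a d)) => [ad|/negbTE->//]; case: ifP => ard.
    by rewrite -face_next_rev aL ard.
  by rewrite aL.
have psi_out d : src d \notin O -> a d -> psi d = sigma d.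
  by move=> sO ad; rewrite psiE ad a_out // ad.
have psi_in d : src d \in O -> a d -> d != perm_dart (src d) -> psi d = perm_dart (src d).
  move=> sO ad nd; have ard := a_int _ sO ad nd; rewrite psiE ad ard.
  have asd : a (sigma d) by rewrite -face_next_rev aL.
  have pE : src d = src (perm_dart (src d)) by [].
  case: (sigma_orbit cubicG rotG pE) => [E|->//|E]; first by rewrite -E eqxx in nd.
  have uO : pi^-1%g (src d) \in O by rewrite -Opi permKV.
  have rE : src d = src (rd (perm_dart (pi^-1%g (src d)))) by rewrite src_rev tgt_pd permKV.
  have := aOr _ uO; case: (sigma_orbit cubicG rotG rE) => ->; rewrite ?ad ?asd //.
  by rewrite -E aO.
have porb1 d : porbit psi (psi d) = porbit psi d by exact: (porbit_perm psi 1 d).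
have porb_in d : src d \in O -> a d -> porbit psi d = porbit psi (perm_dart (src d)).
  move=> sO ad; case: (eqVneq d (perm_dart (src d))) => [<-//|nd].
  by rewrite -(psi_in d) // porb1.
have porb_pi v : v \in O -> porbit psi (perm_dart (pi v)) = porbit psi (perm_dart v).
  move=> vO; rewrite -[RHS]porb1 psiE aO // aOr //.
  have sL : src (L (perm_dart v)) = pi v by rewrite src_face_next.
  by rewrite [RHS]porb_in ?sL ?Opi // aL aO.
have porb_all v : v \in O -> porbit psi (perm_dart v) = porbit psi (perm_dart v0).
  case/porbitP=> i ->; rewrite permX; elim: i => //= i <-.
  by apply: porb_pi; rewrite -permX mem_porbit.
pose mark d := (d == perm_dart (src d)) && ((src d \notin O) || (src d == v0)).
have a_at d d' : src d \notin O -> src d = src d' -> a d' = a d.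
  have as_ z : src z \notin O -> a (sigma z) = a z by move=> zO;
    rewrite -face_next_rev aL a_out.
  by move=> sO /(sigma_orbit cubicG rotG)[->|->|->] //; rewrite ?as_ // src_sigma.
have v0O : v0 \in O by exact: porbit_id.
have -> : odd_perm psi = odd #|A| (+) odd #|[set d in A | mark d]|.
  apply: (odd_perm_marked (p := psi)) => [d|d|d]; first by rewrite !inE psi_a.
    by rewrite inE psiE; case: (a d).
  rewrite inE => ad; have [sO|sO] := boolP (src d \in O).
    rewrite (_ : [set _ in _ | _] = [set perm_dart v0]) ?cards1 //.
    apply/setP=> x; rewrite !inE /mark; apply/andP/eqP => [[xd /andP[/eqP xE]]|->].
      have : x \in [set z | src z \in O].
        by rewrite (porbit_stable _ xd) ?inE // => z; rewrite !inE psi_src.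
      by rewrite inE => -> /= /eqP xv; rewrite xE xv.
    by rewrite src_pd !eqxx orbT -eq_porbit_mem (porb_in d) // porb_all.
  rewrite (_ : [set _ in _ | _] = [set perm_dart (src d)]) ?cards1 //.
  apply/setP=> x; rewrite !inE /mark; apply/andP/eqP => [[xd /andP[/eqP xE _]]|->].
    rewrite xE; congr (perm_dart _); case/porbitP: xd => i ->; rewrite permX.
    suff : src (iter i psi d) = src d /\ a (iter i psi d) by case.
    by elim: i => //= i [IH1 IH2]; rewrite psi_a IH2 psi_out ?src_sigma ?IH1.
  rewrite src_pd eqxx sO; split=> //.
  have pE : src d = src (perm_dart (src d)) by [].
  case: (sigma_orbit cubicG rotG pE) => ->; rewrite ?porbit_id //.
    by rewrite -(psi_out d) // (mem_porbit psi 1 d).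
  have -> : sigma (sigma d) = (psi ^+ 2)%g d by rewrite permX /= !psi_out ?src_sigma //
    -psi_out ?psi_a.
  exact: mem_porbit.
pose N := [set v | (v \notin O) && a (perm_dart v)].
have -> : [set d in A | mark d] = perm_dart @: (v0 |: N).
  apply/setP=> d; rewrite !inE; apply/and3P/imsetP => [[ad /eqP dE]|[v]].
    move=> H; exists (src d) => //; rewrite !inE -dE ad andbT.
    by case/orP: H => ->; rewrite ?orbT.
  rewrite !inE => /orP[/eqP ->|/andP[vO av]] ->; rewrite src_pd !eqxx ?orbT;
    first by rewrite aO.
  by rewrite vO av.
have pd_inj : injective perm_dart by move=> v w /(congr1 (@src G)).
rewrite (card_imset _ pd_inj) cardsU1 inE v0O (negbTE even_A) /= oddD.
(* [N] is the set of vertices strictly inside. An edge leaving a vertex off the cycle has the region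
   on both sides or on neither, so [pi] preserves [N], and its orbits there are even. *)
suff -> : odd #|N| = false by [].
apply/negbTE/(@even_stable _ pi) => [v|v _]; last exact: pieven.
rewrite !inE Opi; case: (boolP (v \in O)) => //= vO.
rewrite -(a_out (perm_dart v)) //; apply/esym/esym; apply: a_at => //.
by rewrite src_rev tgt_pd Opi.
Qed.

End LongCycle.

(** A cycle of length 2 uses both darts of one edge, exactly one of which is marked; longer cycles
    need the region argument. *)
Lemma odd_cycle v : odd #|[set w in porbit pi v | s (perm_dart w)]|.
Proof.
have [/odd_2cycle//|/eqP] := eqVneq (pi (pi v)) v; exact: odd_long_cycle.
Qed.

Lemma odd_perm_sign : odd_perm pi = odd #|[set v | s (perm_dart v)]|.
Proof.
have even_n : ~~ odd #|G|.
  by have := card_darts cubicG; have := card_edges G; lia.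
have := @odd_perm_marked _ pi pi setT (fun v => s (perm_dart v)).
rewrite cardsT (negbTE even_n) => -> //; try by move=> z; rewrite ?inE.
  by congr (odd #|pred_of_set _|); apply/setP=> v; rewrite !inE.
by move=> v _; exact: odd_cycle.
Qed.

End CycleSign.

(** * Pairs of perfect matchings and the determinant *)

Section MatchingPairs.
Variable T : finType.
Variables m1 m2 : T -> T.
Hypotheses (m1K : involutive m1) (m2K : involutive m2).
Hypotheses (m1n : forall v, m1 v != v) (m2n : forall v, m2 v != v).

Lemma comp_inj_subproof : injective (m2 \o m1).
Proof. by apply: inj_comp; exact: inv_inj. Qed.

Let mu := perm comp_inj_subproof.
Let muE v : mu v = m2 (m1 v). Proof. exact: permE. Qed.
Let mu_m1 v : mu (m1 (mu v)) = m1 v. Proof. by rewrite !muE m1K m2K. Qed.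
Let porb1 p v : porbit p (p v) = porbit p v :> {set T}.
Proof. exact: (porbit_perm p 1 v). Qed.

(** Conjugation by [m1] inverts [mu], so a relation m1 v = mu^k v descends from k to k - 2 and ends
    in a fixed point of [m1] or [m2]. Hence each component of the union splits into two orbits of
    [mu]. *)
Let m1_notin v : m1 v \notin porbit mu v.
Proof.
apply/negP=> /porbitP[k]; rewrite permX; elim/ltn_ind: k v => -[|[|k]] IH v /= E.
- by have := m1n v; rewrite E eqxx.
- by have := m2n (m1 v); rewrite -muE -E eqxx.
- apply: (IH k _ (mu v)) => //; apply: (@perm_inj _ mu).
  by rewrite mu_m1 E -iterSr.
Qed.

Let comp v := porbit mu v :|: porbit mu (m1 v).

Let porb_m2 v : porbit mu (m2 v) = porbit mu (m1 v).
Proof. by rewrite -{1}[v]m1K -muE porb1. Qed.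

Let comp_m1 v : comp (m1 v) = comp v.
Proof. by rewrite /comp m1K setUC. Qed.

Let comp_mu v : comp (mu v) = comp v.
Proof. by rewrite /comp porb1 -(mu_m1 v) porb1. Qed.

Let comp_m2 v : comp (m2 v) = comp v.
Proof. by rewrite -{1}[v]m1K -muE comp_mu comp_m1. Qed.

Let comp_mem v w : w \in comp v -> comp w = comp v.
Proof.
have H u : w \in porbit mu u -> comp w = comp u.
  by case/porbitP=> i ->; rewrite permX; elim: i => //= i <-; rewrite comp_mu.
by rewrite inE => /orP[/H//|/H]; rewrite comp_m1.
Qed.

(** For nonempty [C] the default [v] is not reached, so the choice depends on the set alone and
    [decode_pair] can repeat it. *)
Let rep (C : {set T}) v := odflt v [pick z in C].

Let rep_in v : rep (comp v) v \in comp v.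
Proof.
by rewrite /rep; case: pickP => //= /(_ v); rewrite /comp inE porbit_id.
Qed.

Let rep_eq (C : {set T}) v w : v \in C -> rep C v = rep C w.
Proof. by rewrite /rep; case: pickP => //= /(_ v) ->. Qed.

Let v_comp v : v \in comp v. Proof. by rewrite inE porbit_id. Qed.

(** A proper 2-colouring of the union of the matchings: both [m1] and [m2] change the colour. *)
Let b v := v \in porbit mu (rep (comp v) v).

Let b_porb v w : porbit mu v = porbit mu w -> comp v = comp w -> b v = b w.
Proof.
move=> E C; rewrite /b -!eq_porbit_mem E C (@rep_eq _ v w) //.
by rewrite -C v_comp.
Qed.

Let b_m1 v : b (m1 v) = ~~ b v.
Proof.
rewrite /b comp_m1 (@rep_eq _ (m1 v) v); last by rewrite -comp_m1 v_comp.
have := rep_in v; move: (rep _ _) => x; rewrite inE.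
have [xv _|xv /= xm] := boolP (x \in porbit mu v).
  have E : porbit mu x = porbit mu v by apply/eqP; rewrite eq_porbit_mem.
  by rewrite E porbit_id (negbTE (m1_notin v)).
have E : porbit mu x = porbit mu (m1 v) by apply/eqP; rewrite eq_porbit_mem.
by rewrite [v \in _]porbit_sym (negbTE xv) E porbit_id.
Qed.

Let b_m2 v : b (m2 v) = ~~ b v.
Proof. by rewrite -b_m1; apply: b_porb; rewrite ?porb_m2 // comp_m1 comp_m2. Qed.

Let pf v := if b v then m1 v else m2 v.

Let b_pf v : b (pf v) = ~~ b v.
Proof. by rewrite /pf; case: ifP => bv; rewrite ?b_m1 ?b_m2 bv. Qed.

Let pf_inj : injective pf.
Proof.
move=> v w E; have := congr1 b E; rewrite !b_pf => /negb_inj bE.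
by move: E; rewrite /pf bE; case: (b w); exact/inv_inj.
Qed.

Let pi := perm pf_inj.
Let piE v : pi v = pf v. Proof. exact: permE. Qed.

Let pi2 v : pi (pi v) = if b v then mu v else (mu^-1)%g v.
Proof.
rewrite !piE {1}/pf b_pf /pf; case: (b v) => /=; first by rewrite muE.
by apply: (@perm_inj _ mu); rewrite permKV muE m1K m2K.
Qed.

Let porb_pi2 v : porbit (pi * pi)%g v = porbit mu v.
Proof.
have bmu u : b (mu u) = b u by rewrite muE b_m2 b_m1 negbK.
case: (boolP (b v)) => bv.
  suff E i : ((pi * pi) ^+ i)%g v = (mu ^+ i)%g v.
    by apply/setP=> x; apply/porbitP/porbitP => -[i ->]; exists i; rewrite E.
  rewrite !permX; suff : b (iter i mu v) /\ iter i (pi * pi)%g v = iter i mu v by case.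
  elim: i => //= i [bi ->]; rewrite bmu bi permM pi2 bi; by [].
rewrite -(porbitV mu).
suff E i : ((pi * pi) ^+ i)%g v = (mu^-1 ^+ i)%g v.
  by apply/setP=> x; apply/porbitP/porbitP => -[i ->]; exists i; rewrite E.
rewrite !permX; suff : ~~ b (iter i mu^-1%g v) /\ iter i (pi * pi)%g v =
  iter i mu^-1%g v by case.
elim: i => //= i [bi ->]; rewrite -bmu permKV bi permM pi2 (negbTE bi); by [].
Qed.

Let porb_pi v : porbit pi v = comp v.
Proof.
have sub u : porbit mu u \subset porbit pi u.
  rewrite -porb_pi2; apply/subsetP=> x /porbitP[i ->].
  rewrite permX; elim: i => [|i IH] /=; first exact: porbit_id.
  by rewrite permM -eq_porbit_mem !porb1 eq_porbit_mem.
apply/eqP; rewrite eqEsubset; apply/andP; split.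
  apply/subsetP=> x /porbitP[i ->]; rewrite permX.
  elim: i => [|i IH] /=; first exact: v_comp.
  rewrite -(comp_mem IH) piE /pf; case: ifP => _; first by rewrite -comp_m1 v_comp.
  by rewrite -comp_m2 v_comp.
rewrite subUset sub /=; case: (boolP (b v)) => bv.
  have -> : m1 v = pi v by rewrite piE /pf bv.
  by rewrite -[in X in _ \subset X]porb1 sub.
rewrite -porb_m2; have -> : m2 v = pi v by rewrite piE /pf (negbTE bv).
by rewrite -[in X in _ \subset X]porb1 sub.
Qed.

(* The cycles of pi are those of the union of the two matchings. Each one is  *)
(* directed so that its representative is left along m1; the representative   *)
(* depends on the cycle only, so the two matchings can be recovered.          *)
Definition decode_pair (p : {perm T}) : {ffun T -> T} * {ffun T -> T} :=
  let c v := v \in porbit (p * p)%g (odflt v [pick z in porbit p v]) in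
  ([ffun v => if c v then p v else (p^-1)%g v],
   [ffun v => if c v then (p^-1)%g v else p v]).

Lemma superposition : exists p : {perm T},
  [/\ decode_pair p = ([ffun v => m1 v], [ffun v => m2 v]),
      forall v, p v = m1 v \/ p v = m2 v &
      forall v, ~~ odd #|porbit p v|].
Proof.
exists pi; split=> [|v|v].
- have cE v : (v \in porbit (pi * pi)%g (odflt v [pick z in porbit pi v])) = b v.
    by rewrite porb_pi2 porb_pi.
  congr (_, _); apply/ffunP=> v; rewrite !ffunE cE; case: (boolP (b v)) => bv.
  + by rewrite piE /pf bv.
  + by apply: (@perm_inj _ pi); rewrite permKV piE /pf b_m1 bv m1K.
  + by apply: (@perm_inj _ pi); rewrite permKV piE /pf b_m2 bv m2K.
  + by rewrite piE /pf (negbTE bv).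
- by rewrite piE /pf; case: (b v); [left|right].
(* [pi] swaps the two colours, so every orbit has as many points of either colour. *)
- have -> : #|porbit pi v| = #|[set x in porbit pi v | b x]| + #|[set x in porbit pi v
  | ~~ b x]|.
    rewrite -(cardsID [set x | b x] (porbit pi v)); congr (_ + _);
    by apply: eq_card => x; rewrite !inE // andbC.
  have -> : [set x in porbit pi v | ~~ b x] = pi @: [set x in porbit pi v | b x].
    apply/setP=> x; rewrite !inE; apply/idP/imsetP => [/andP[xv bx]|[y]].
      exists (pi^-1%g x); last by rewrite permKV.
      rewrite inE -eq_porbit_mem -porb1 permKV eq_porbit_mem xv /=.
      by move: bx; rewrite -{1}[x](permKV pi) piE b_pf negbK.
    by rewrite inE => /andP[yv bby] ->;
      rewrite -eq_porbit_mem porb1 eq_porbit_mem yv piE b_pf bby.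
  by rewrite (card_imset _ (@perm_inj _ pi)) addnn odd_double.
Qed.

End MatchingPairs.

(** * Leibniz expansion of a skew-symmetric determinant *)

Section Determinant.
Local Open Scope ring_scope.

Lemma det_enum (R : comNzRingType) (T : finType) (f : T -> T -> R) :
  \det (\matrix_(i < #|T|, j < #|T|) f (enum_val i) (enum_val j)) =
  \sum_(p : {perm T}) (-1) ^+ p * \prod_v f v (p v).
Proof.
have inj1 (p : {perm T}) : injective (fun i : 'I_#|T| => enum_rank (p (enum_val i))).
  by move=> i j /enum_rank_inj/perm_inj/enum_val_inj.
have inj2 (q : {perm 'I_#|T|}) : injective (fun v : T => enum_val (q (enum_rank v))).
  by move=> v w /enum_val_inj/perm_inj/enum_rank_inj.
rewrite /determinant (reindex (fun p : {perm T} => perm (inj1 p))) /=; last first.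
  exists (fun q : {perm 'I_#|T|} => perm (inj2 q)) => p _; apply/permP=> x;
  by rewrite !permE /= ?permE ?enum_valK ?enum_rankK.
apply: eq_bigr => p _; congr (_ * _).
  have -> : odd_perm (perm (inj1 p)) = odd_perm p; last by [].
  rewrite /odd_perm card_ord; congr (_ (+) odd _).
  set q := perm (inj1 p).
  have -> : porbits p = (fun O : {set 'I_#|T|} => enum_val @: O) @: porbits q.
    have E i : porbit p (enum_val i) = enum_val @: porbit q i.
      have Ek k : (p ^+ k)%g (enum_val i) = enum_val ((q ^+ k)%g i).
        by rewrite !permX; elim: k => //= k ->; rewrite permE enum_rankK.
      apply/setP=> x; apply/porbitP/imsetP => [[k ->]|[j /porbitP[k ->] ->]].
        by exists ((q ^+ k)%g i); rewrite ?mem_porbit.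
      by exists k.
    apply/setP=> O; apply/imsetP/imsetP => [[x _ ->]|[_ /imsetP[i _ ->] ->]].
      exists (porbit q (enum_rank x)); first exact: imset_f.
      by rewrite -E enum_rankK.
    by exists (enum_val i).
  rewrite [RHS]card_imset // => A B E; apply/setP=> i.
  by rewrite -(mem_imset A i enum_val_inj) E (mem_imset _ _ enum_val_inj).
rewrite (reindex_onto enum_rank enum_val) /=; last by move=> i _; rewrite enum_valK.
apply: eq_big => [v|v _]; first by rewrite enum_rankK eqxx.
by rewrite !mxE permE !enum_rankK.
Qed.

Definition even_orbits (T : finType) (p : {perm T}) := [forall v, ~~ odd #|porbit p v|].

Section Flip.
Variables (T : finType) (p : {perm T}) (x0 : T).
Local Notation O := (porbit p x0).

Let stO x : (p x \in O) = (x \in O).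
Proof. by rewrite -!eq_porbit_mem (porbit_perm p 1 x). Qed.

Let stVO x : (p^-1%g x \in O) = (x \in O).
Proof. by rewrite -[in RHS](permKV p x) stO. Qed.

Lemma flip_inj : injective (fun x => if x \in O then p^-1%g x else p x).
Proof.
move=> x y; case: ifP => xO; case: ifP => yO //; try exact: perm_inj.
  by move=> E; have := stO y; rewrite -E stVO xO yO.
by move=> E; have := stO x; rewrite E stVO xO yO.
Qed.

Definition flip := perm flip_inj.

Lemma flipE x : flip x = if x \in O then p^-1%g x else p x.
Proof. exact: permE. Qed.

Lemma porbit_flip x : porbit flip x = porbit p x.
Proof.
have [xO|xO] := boolP (x \in O).
  rewrite -(porbitV p); apply/setP=> y.
  suff E i : (flip ^+ i)%g x = ((p^-1) ^+ i)%g x.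
    by apply/porbitP/porbitP => -[i ->]; exists i; rewrite E.
  rewrite !permX; suff : iter i p^-1%g x \in O /\ iter i flip x = iter i p^-1%g x by case.
  by elim: i => //= i [iO ->]; rewrite stVO flipE iO.
apply/setP=> y; suff E i : (flip ^+ i)%g x = (p ^+ i)%g x.
  by apply/porbitP/porbitP => -[i ->]; exists i; rewrite E.
rewrite !permX; suff : iter i p x \notin O /\ iter i flip x = iter i p x by case.
by elim: i => //= i [iO ->]; rewrite stO flipE (negbTE iO).
Qed.

Lemma odd_perm_flip : odd_perm flip = odd_perm p.
Proof.
by rewrite /odd_perm; congr (_ (+) odd #|pred_of_set _|); apply: eq_imset => x;
  exact: porbit_flip.
Qed.

Lemma prod_flip (R : comNzRingType) (f : T -> T -> R) : (forall v w, f v w = - f w v) ->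
  odd #|O| -> \prod_v f v (flip v) = - \prod_v f v (p v).
Proof.
move=> fskew oO; rewrite (bigID (mem O)) /= [in RHS](bigID (mem O)) /= -mulNr;
  congr (_ * _); last first.
  by apply: eq_bigr => v vO; rewrite flipE (negbTE vO).
rewrite (reindex_inj (@perm_inj _ p)) /=.
rewrite (eq_bigl (mem O)) => [|v]; last by rewrite stO.
rewrite (eq_bigr (fun v => - f v (p v))) => [|v vO].
  by rewrite prodrN -signr_odd oO expr1 mulN1r.
by rewrite flipE stO (vO : v \in O) permK fskew.
Qed.

End Flip.

Lemma flipK (T : finType) (p : {perm T}) x0 : flip (flip p x0) x0 = p.
Proof.
apply/permP=> x; rewrite flipE porbit_flip; case: ifP => xO; last by rewrite flipE xO.
by apply: (@perm_inj _ (flip p x0));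
  rewrite permKV flipE -eq_porbit_mem (porbit_perm p 1 x) eq_porbit_mem xO permK.
Qed.

(** Reversing one odd orbit keeps the sign of the permutation and negates the product. The orbit is
    chosen from the orbit partition, which the reversal preserves, so this is an involution; it
    shows that the remaining sum equals its own opposite, hence is 0. *)
Lemma skew_det_even (R : numDomainType) (T : finType) (f : T -> T -> R) :
  (forall v w, f v w = - f w v) ->
  \sum_(p : {perm T}) (-1) ^+ p * \prod_v f v (p v) =
  \sum_(p : {perm T} | even_orbits p) (-1) ^+ p * \prod_v f v (p v).
Proof.
move=> fskew; rewrite (bigID (@even_orbits T)) /= [X in _ + X](_ : _ = 0) ?addr0 //.
pose io (p : {perm T}) := if [pick x | odd #|porbit p x|] is Some x then flip p x else p.
have pickE (p : {perm T}) x : [pick z | odd #|porbit (flip p x) z|] =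
  [pick z | odd #|porbit p z|].
  by apply: eq_pick => z /=; rewrite porbit_flip.
have ioK : involutive io.
  move=> p; rewrite {2}/io; case E: [pick _ | _] => [x|]; last by rewrite /io E.
  by rewrite /io pickE E flipK.
set S := LHS; suff : S = - S by move/eqP; rewrite -addr_eq0 -mulr2n mulrn_eq0 => /eqP.
rewrite {1}/S (reindex_inj (inv_inj ioK)) /= -sumrN; apply: eq_big => [p|p].
  rewrite /io; case: pickP => // x _; rewrite /even_orbits; congr (~~ _).
  by apply: eq_forallb => v; rewrite porbit_flip.
rewrite /even_orbits /io; case: pickP => [x ox _|no /forallPn[v]]; last by rewrite no.
by rewrite odd_perm_flip prod_flip // mulrN.
Qed.

End Determinant.

(** * Determinant of a sparse skew-symmetric matrix *)

Section SpectralBound.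
Local Open Scope ring_scope.
Variable C : numClosedFieldType.

(** Compare both sides of the eigenvector equation at a coordinate of largest modulus. *)
Lemma eigenvalue_le_col_sum n (K : 'M[C]_n) (c a : C) (v : 'rV_n) :
  (forall j, \sum_i `|K i j| <= c) -> v != 0 -> v *m K = a *: v -> `|a| <= c.
Proof.
move=> sumK /rV0Pn[j0 vj0] vK.
have [|j _ jmax] := @real_arg_maxP C _ j0 xpredT (fun j => `|v 0 j|) isT.
  by move=> j _; exact: normr_real.
have vj : 0 < `|v 0 j| by apply: lt_le_trans (jmax j0 isT); rewrite normr_gt0.
rewrite -(ler_pM2r vj) -normrM.
have -> : a * v 0 j = \sum_i v 0 i * K i j.
  by have /rowP/(_ j) := vK; rewrite !mxE => <-.
apply: le_trans (ler_norm_sum _ _ _) _.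
apply: (@le_trans _ _ (\sum_i `|K i j| * `|v 0 j|)).
  by apply: ler_sum => i _; rewrite normrM mulrC ler_wpM2l //; exact: jmax.
by rewrite -mulr_suml ler_pM2r // sumK.
Qed.

(* With t = 3 (1 + x), this is 1 + x <= (1 + x/2 - x^2/16)^2 for -1 <= x <= 2. *)
Definition sqrt_majorant (t : C) : C := 1 + (t / 3 - 1) / 2 - (t / 3 - 1) ^+ 2 / 16.

Lemma sqrt_majorant_ge0 t : 0 <= t <= 9 -> 0 <= sqrt_majorant t.
Proof.
move=> /andP[t0 t9].
have -> : sqrt_majorant t = ((9 - t) / 3 * (t / 3) + 7 * (t / 3) + 7) / 16.
  by rewrite /sqrt_majorant; field.
have t90 : 0 <= 9 - t by rewrite subr_ge0.
by rewrite divr_ge0 // !addr_ge0 // !mulr_ge0 // ?invr_ge0.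
Qed.

Lemma le_sqrt_majorant t : 0 <= t <= 9 -> t <= 3 * sqrt_majorant t ^+ 2.
Proof.
move=> /andP[t0 t9]; rewrite -subr_ge0.
have -> : 3 * sqrt_majorant t ^+ 2 - t =
  3 * (t / 3 - 1) ^+ 2 * ((9 - t) / 3 * ((9 - t) / 3 + 12) + 4) / 256.
  by rewrite /sqrt_majorant; field.
have t90 : 0 <= 9 - t by rewrite subr_ge0.
have xr : t / 3 - 1 \is Num.real.
  by rewrite realB ?real1 // ger0_real // divr_ge0.
have x2 : 0 <= (t / 3 - 1) ^+ 2 by rewrite real_exprn_even_ge0.
have c1 : 0 <= (9 - t) / 3 * ((9 - t) / 3 + 12) + 4.
  by rewrite addr_ge0 // mulr_ge0 ?addr_ge0 ?divr_ge0.
by rewrite divr_ge0 // mulr_ge0 // mulr_ge0.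
Qed.

(** AM-GM for the majorants. In terms of x = t/3 - 1, the mean of x is 0 and that of x^2 is 15/9 - 1
    = 2/3, so the majorant has mean 1 - (2/3)/16 = 23/24. *)
Lemma prod_le_trace_bound n (t : 'I_n -> C) :
  (forall i, 0 <= t i <= 9) -> \sum_i t i = 3 * n%:R -> \sum_i t i ^+ 2 = 15 * n%:R ->
  \prod_i t i <= (3 * (23 / 24) ^+ 2) ^+ n.
Proof.
case: n t => [|n] t tb s1 s2; first by rewrite big_ord0.
have u0 i : 0 <= sqrt_majorant (t i) by exact: sqrt_majorant_ge0.
have le1 : \prod_i t i <= \prod_i (3 * sqrt_majorant (t i) ^+ 2).
  by apply: ler_prod => i _; rewrite le_sqrt_majorant // andbT; case/andP: (tb i).
apply: le_trans le1 _; rewrite big_split /= prodr_const card_ord prodrXl.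
rewrite exprMn -exprM mulnC exprM ler_pM2l ?exprn_gt0 // lerXn2r ?nnegrE //.
- by apply: prodr_ge0.
- by apply: exprn_ge0; rewrite divr_ge0.
have [+ _] := leif_AGM (A := predT) (E := fun i => sqrt_majorant (t i)) (fun i _ => u0 i).
rewrite !card_ord /= => /le_trans; apply.
suff -> : \sum_(i < n.+1) sqrt_majorant (t i) = 23 / 24 * n.+1%:R.
  by rewrite mulfK // pnatr_eq0.
have -> : 23 / 24 * n.+1%:R = 7 / 16 * n.+1%:R + 5 / 24 * (\sum_i t i) - (\sum_i t i ^+
  2) / 144 :> C.
  by rewrite s1 s2; field.
rewrite mulr_sumr mulr_suml -sumrN.
have -> : 7 / 16 * n.+1%:R = \sum_(i < n.+1) 7 / 16 :> C.
  by rewrite sumr_const card_ord mulr_natr.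
by rewrite -!big_split /=; apply: eq_bigr => i _; rewrite /sqrt_majorant; field.
Qed.

Local Open Scope sesquilinear_scope.

(* The eigenvalues are purely imaginary, hence |l|^2 = - l^2, so the traces   *)
(* give the first two moments of the squared moduli.                          *)
Lemma det_skew_le n (K : 'M[C]_n) :
  K \is a mxOver Num.real -> K^T = - K -> (forall j, \sum_i `|K i j| <= 3) ->
  \tr (K *m K) = - (3 * n%:R) -> \tr ((K *m K) *m (K *m K)) = 15 * n%:R ->
  `|\det K| ^+ 2 <= (3 * (23 / 24) ^+ 2) ^+ n.
Proof.
move=> Kreal Kskew sumK tr2 tr4.
have Kadj : K^t* = - K by rewrite Kskew map_mxN realmxC.
have Knormal : K \is normalmx.
  by apply/normalmxP; rewrite Kadj mulNmx mulmxN.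
have := orthomx_spectralP Knormal.
set P := spectralmx K; set D := spectral_diag K => KE.
have Pu : P \in unitmx by exact: spectral_unit.
have PK : P *m K = diag_mx D *m P by rewrite KE !mulmxA mulmxV // mul1mx.
have DE : diag_mx D = P *m K *m invmx P by rewrite PK mulmxK.
have Dadj i : (D 0 i)^* = - D 0 i.
  have : (diag_mx D)^t* = - diag_mx D.
    rewrite {1}DE invmx_unitary ?spectral_unitarymx // !trmx_mul !map_mxM trmxCK Kadj.
    by rewrite mulNmx mulmxN mulmxA -invmx_unitary ?spectral_unitarymx // -DE.
  by move/matrixP/(_ i i); rewrite !mxE eqxx.
have conjP (d : 'rV[C]_n) : \tr (invmx P *m diag_mx d *m P) = \sum_i d 0 i.
  by rewrite mxtrace_mulC mulmxA mulmxV // mul1mx mxtrace_diag.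
have mulP (d e : 'rV[C]_n) : (invmx P *m diag_mx d *m P) *m (invmx P *m diag_mx e *m P)
    = invmx P *m diag_mx (\row_i (d 0 i * e 0 i)) *m P.
  rewrite !mulmxA mulmxK // -(mulmxA (invmx P)); congr (_ *m _ *m _).
  by apply/matrixP=> i j; rewrite mul_diag_mx !mxE; case: eqP => [->|];
    rewrite ?mulr0n ?mulr0.
have normD i : `|D 0 i| ^+ 2 = - (D 0 i ^+ 2).
  by rewrite normCK Dadj mulrN.
have detE : \det K = \prod_i D 0 i.
  by rewrite KE !det_mulmx mulrAC -det_mulmx mulVmx // det1 mul1r det_diag.
rewrite detE normr_prod -prodrXl; apply: prod_le_trace_bound => [i||].
- have -> : 9 = 3 ^+ 2 :> C by ring.
  rewrite exprn_ge0 //= lerXn2r ?nnegrE //.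
  apply: (@eigenvalue_le_col_sum _ K _ _ (row i P)) => //.
    apply: contraTneq Pu => P0; rewrite -row_free_unit.
    by apply/negP=> /row_freeP[Q] /(congr1 (row i));
      rewrite row_mul P0 mul0mx => /rowP/(_ i); rewrite !mxE eqxx => /eqP; rewrite eq_sym oner_eq0.
  by rewrite -row_mul PK row_mul row_diag_mx -scalemxAl -rowE.
- under eq_bigr do rewrite normD.
  by rewrite sumrN -[RHS]opprK -tr2 KE mulP conjP; congr (- _); apply: eq_bigr => i _;
    rewrite mxE.
- under eq_bigr do rewrite normD sqrrN.
  by rewrite -tr4 KE !mulP conjP; apply: eq_bigr => i _; rewrite !mxE.
Qed.

End SpectralBound.

(** * The bound on the number of perfect matchings *)

Section Matchings.
Variable G : sgraph.

Definition mates : {set {ffun G -> G}} :=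
  [set m : {ffun G -> G} | [forall v, adj v (m v) && (m (m v) == v)]].

(** Every perfect matching is the set of pairs {v, m v} for the involution [m] sending a vertex to
    its partner. *)
Lemma perfmat_le_mates : perfmat G <= #|mates|.
Proof.
pose e (m : {ffun G -> G}) : {set {set G}} := [set [set v; m v] | v : G].
apply: leq_trans (leq_imset_card e mates); apply/subset_leq_card/subsetP=> M.
rewrite inE => /andP[/subsetP Medge /forallP Mcov].
have uniqM v f g : f \in M -> g \in M -> v \in f -> v \in g -> f = g.
  move=> fM gM vf vg; have /cards1P[h hE] := Mcov v.
  have : f \in [set f in M | v \in f] by rewrite inE fM.
  have : g \in [set f in M | v \in f] by rewrite inE gM.
  by rewrite hE !inE => /eqP -> /eqP.
have exM v : exists w, [set v; w] \in M.
  have /cards1P[f fE] := Mcov v.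
  have : f \in [set f in M | v \in f] by rewrite fE set11.
  rewrite inE => /andP[fM]; have := Medge f fM; rewrite inE.
  case/existsP=> x /existsP[y /andP[_ /eqP fxy]]; rewrite fxy !inE in fM *.
  by case/orP=> /eqP ->; [exists y|exists x; rewrite setUC].
pose m : {ffun G -> G} := [ffun v => xchoose (exM v)].
have mM v : [set v; m v] \in M by rewrite ffunE; exact: (xchooseP (exM v)).
have madj v : adj v (m v).
  have := Medge _ (mM v); rewrite inE => /existsP[x /existsP[y /andP[xy /eqP E]]].
  have xin : x \in [set v; m v] by rewrite E set21.
  have yin : y \in [set v; m v] by rewrite E set22.
  have nxy : x <> y by move=> xy'; move: xy; rewrite xy' adj_irr.
  move: xin yin; rewrite !inE => /orP[]/eqP xE /orP[]/eqP yE.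
  - by case: nxy; rewrite xE yE.
  - by rewrite -yE -xE.
  - by rewrite -xE -yE adj_sym.
  - by case: nxy; rewrite xE yE.
apply/imsetP; exists m.
  rewrite inE; apply/forallP=> v; rewrite madj /=.
  have E : [set v; m v] = [set m v; m (m v)] by apply: (uniqM (m v));
    rewrite ?mM ?set22 ?set21.
  have : v \in [set m v; m (m v)] by rewrite -E set21.
  rewrite !inE eq_sym => /orP[/eqP vE|/eqP <-//].
  by have := madj v; rewrite vE adj_irr.
apply/setP=> f; apply/idP/imsetP => [fM|[v _ ->]]; last exact: mM.
have := Medge f fM; rewrite inE => /existsP[x /existsP[y /andP[_ /eqP fxy]]].
exists x => //; apply: (uniqM x) => //; first by rewrite fxy set21.
exact: set21.
Qed.

Definition even_walks : {set {perm G}} :=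
  [set p | even_orbits p && [forall v, adj v (p v)]].

(** [decode_pair] maps the even permutations along edges onto a set containing all pairs of
    mates. *)
Lemma mates_le_even_walks : #|mates| ^ 2 <= #|even_walks|.
Proof.
rewrite -mulnn -cardsX; apply: leq_trans (leq_imset_card (@decode_pair G) _).
apply/subset_leq_card/subsetP=> -[m1 m2]; rewrite !inE /= => /andP[/forallP H1 /forallP H2].
have m1K : involutive m1 by move=> v; have /andP[_ /eqP] := H1 v.
have m2K : involutive m2 by move=> v; have /andP[_ /eqP] := H2 v.
have a1 v : adj v (m1 v) by have /andP[] := H1 v.
have a2 v : adj v (m2 v) by have /andP[] := H2 v.
have n1 v : m1 v != v by apply/eqP=> E; have := a1 v; rewrite E adj_irr.
have n2 v : m2 v != v by apply/eqP=> E; have := a2 v; rewrite E adj_irr.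
have [p [dE pE pev]] := superposition m1K m2K n1 n2.
apply/imsetP; exists p.
  rewrite inE; apply/andP; split; first exact/forallP.
  by apply/forallP=> v; case: (pE v) => ->.
by rewrite dE; congr (_, _); apply/ffunP=> v; rewrite ffunE.
Qed.

Lemma perfmat_sqr_le : perfmat G ^ 2 <= #|even_walks|.
Proof. by apply: leq_trans mates_le_even_walks; rewrite leq_sqr perfmat_le_mates. Qed.

End Matchings.

Section EnumMatrix.
Local Open Scope ring_scope.
Variables (R : comNzRingType) (T : finType).

Definition enum_mx (f : T -> T -> R) : 'M[R]_#|T| :=
  \matrix_(i, j) f (enum_val i) (enum_val j).

Lemma sum_enum_val (F : T -> R) : \sum_(i < #|T|) F (enum_val i) = \sum_v F v.
Proof.
rewrite (reindex_onto enum_rank enum_val) /=; last by move=> i _; rewrite enum_valK.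
by apply: eq_big => [v|v _]; rewrite enum_rankK ?eqxx.
Qed.

Lemma mul_enum_mx f g : enum_mx f *m enum_mx g = enum_mx (fun v w => \sum_u f v u * g u w).
Proof.
apply/matrixP=> i j; rewrite !mxE -sum_enum_val.
by apply: eq_bigr => k _; rewrite !mxE.
Qed.

Lemma tr_enum_mx f : \tr (enum_mx f) = \sum_v f v v.
Proof. by rewrite /mxtrace -sum_enum_val; apply: eq_bigr => i _; rewrite mxE. Qed.

End EnumMatrix.

(** * The Kasteleyn matrix of a cubic plane graph without 4-cycles *)

Section Kasteleyn.
Local Open Scope ring_scope.
Variables (G : sgraph) (sigma : {perm dart G}).
Hypotheses (cubicG : cubic G) (rotG : rotation sigma).
Hypothesis connG : forall x y : G, connect (@adj G) x y.
Hypothesis eulerG : (#|G| + nb_faces sigma = #|edges G| + 2)%N.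
Variable s : dart G -> bool.
Hypothesis srev : forall d, s (rev_dart d) = ~~ s d.
Hypothesis sodd : forall d, odd #|[set d' in porbit (face_perm sigma) d | s d']|.
Hypothesis no4 : forall u a w b : G,
  adj u a -> adj a w -> adj w b -> adj b u -> u != w -> a != b -> False.

Variable C : numClosedFieldType.

Definition kast (v w : G) : C :=
  if (insub (v, w) : option (dart G)) is Some d then (-1) ^+ s d else 0.

Lemma kastE v w (vw : adj v w) : kast v w = (-1) ^+ s (mkdart vw).
Proof. by rewrite /kast insubT. Qed.

Lemma kast0 v w : ~~ adj v w -> kast v w = 0.
Proof. by move=> vw; rewrite /kast insubF //; apply/negbTE. Qed.

Lemma kast_skew v w : kast v w = - kast w v.
Proof.
have [vw|vw] := boolP (adj v w); last by rewrite !kast0 ?oppr0 // adj_sym.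
have wv : adj w v by rewrite adj_sym.
rewrite (kastE vw) (kastE wv); have ->
  : mkdart wv = rev_dart (mkdart vw) by apply: dart_inj.
by rewrite srev signrN opprK.
Qed.

Lemma kast_sqr v w : kast v w * kast v w = (adj v w)%:R.
Proof.
have [vw|vw] := boolP (adj v w); last by rewrite kast0 ?mul0r.
by rewrite (kastE vw) -signr_addb addbb.
Qed.

Lemma norm_kast v w : `|kast v w| = (adj v w)%:R.
Proof.
have [vw|vw] := boolP (adj v w); last by rewrite kast0 ?normr0.
by rewrite (kastE vw) normr_sign.
Qed.

(** The sign of an even permutation along edges equals the product of its matrix entries, so its
    term is 1. *)
Lemma det_kast : \det (enum_mx kast) = #|even_walks G|%:R.
Proof.
rewrite /enum_mx det_enum (skew_det_even kast_skew) -sum1_card natr_sum.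
rewrite big_mkcond [RHS]big_mkcond; apply: eq_bigr => p _; rewrite inE.
case: ifP => //= /forallP pev; case: ifPn => [/forallP padj|/forallPn[v nv]].
  rewrite (eq_bigr (fun v => (-1) ^+ s (perm_dart padj v))) => [|v _]; last exact: kastE.
  rewrite (odd_perm_sign cubicG rotG connG eulerG srev sodd padj pev).
  rewrite (eq_bigr (fun v => (if s (perm_dart padj v) then -1 else 1))) => [|v _];
    last by case: (s _).
  rewrite -big_mkcond prodr_const -[X in _ * X]signr_odd -signr_addb; set A := _ (+) _.
  suff -> : A = false by [].
  rewrite /A (_ : #|[set v | _]| = #|fun v => s (perm_dart padj v)|) ?addbb //.
  by apply: eq_card => v; rewrite inE.
by rewrite (bigD1 v) //= kast0 // mul0r mulr0.
Qed.

Lemma sum_adj (v : G) : \sum_w (adj v w)%:R = 3 :> C.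
Proof.
rewrite -natr_sum -big_mkcond /= sum1_card.
by rewrite -(cubicG v) cardsE.
Qed.

Definition kast2 v w : C := \sum_u kast v u * kast u w.

Lemma kast2_sym v w : kast2 v w = kast2 w v.
Proof.
apply: eq_bigr => u _; rewrite [kast v u]kast_skew [kast u w]kast_skew mulrNN mulrC //.
Qed.

Lemma kast2_diag v : kast2 v v = - 3.
Proof.
rewrite -(sum_adj v) -sumrN; apply: eq_bigr => u _.
by rewrite [kast u v]kast_skew mulrN kast_sqr.
Qed.

(** Without 4-cycles the sum [kast2 v w] has at most one nonzero term, so no cancellation occurs and
    its square counts the common neighbours. *)
Lemma kast2_sqr v w : v != w ->
  kast2 v w * kast2 v w = \sum_u (adj v u)%:R * (adj u w)%:R.
Proof.
move=> vw; have [u /andP[vu uw]|none] := pickP (fun u => adj v u && adj u w).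
  have other x : x != u -> adj v x && adj x w = false.
    move=> xu; apply/negbTE/negP=> /andP[vx xw].
    by apply: (no4 vu uw _ _ vw (_ : u != x)); rewrite 1?eq_sym // adj_sym.
  have -> : kast2 v w = kast v u * kast u w.
    rewrite /kast2 (bigD1 u) //= big1 ?addr0 // => x /other/negbT.
    by rewrite negb_and => /orP[] n; rewrite (kast0 n) ?mul0r ?mulr0.
  rewrite mulrACA !kast_sqr (bigD1 u) //= big1 ?addr0 // => x /other.
  by rewrite -natrM mulnb => ->.
have -> : kast2 v w = 0.
  rewrite /kast2 big1 // => x _; have /negbT := none x.
  by rewrite negb_and => /orP[] n; rewrite (kast0 n) ?mul0r ?mulr0.
by rewrite mul0r big1 // => x _; rewrite -natrM mulnb none.
Qed.

Lemma tr_kast2 : \tr (enum_mx kast *m enum_mx kast) = - (3 * #|G|%:R).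
Proof.
rewrite mul_enum_mx tr_enum_mx (eq_bigr (fun=> - 3)) => [|v _]; last exact: kast2_diag.
by rewrite sumr_const mulNrn mulr_natr.
Qed.

(** Each vertex contributes 3^2 from the diagonal of the squared matrix and 3 * 2 from the paths of
    length 2 leaving it. *)
Lemma tr_kast4 : \tr ((enum_mx kast *m enum_mx kast) *m (enum_mx kast *m enum_mx kast))
  = 15 * #|G|%:R.
Proof.
rewrite !mul_enum_mx tr_enum_mx (eq_bigr (fun=> 15)) => [|v _]; last first.
  rewrite (bigD1 v) //= -!/(kast2 _ _) !kast2_diag.
  rewrite (eq_bigr (fun w => \sum_u (adj v u)%:R * (adj u w)%:R)) => [|w wv]; last first.
    by rewrite -/(kast2 v w) -/(kast2 w v) [kast2 w v]kast2_sym kast2_sqr // eq_sym.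
  rewrite exchange_big /= (eq_bigr (fun u => (adj v u)%:R * 2)) => [|u _].
    by rewrite -mulr_suml sum_adj; ring.
  rewrite -mulr_sumr; have [vu|] := boolP (adj v u); last by rewrite !mul0r.
  congr (_ * _); have := sum_adj u;
    rewrite (bigD1 v) //= adj_sym vu => /(congr1 (fun x => x - 1)).
  by rewrite addrAC subrr add0r => ->; ring.
by rewrite sumr_const mulr_natr.
Qed.

Lemma even_walks_bound : (#|even_walks G| ^ 4 <= 8 ^ #|G|)%N.
Proof.
have := @det_skew_le C _ (enum_mx kast).
rewrite det_kast normr_nat => /(_ _ _ _ tr_kast2 tr_kast4) H.
have {H} : (#|even_walks G|%:R) ^+ 2 <= (3 * (23 / 24) ^+ 2) ^+ #|G| :> C.
  apply: H.
  - apply/mxOverP=> i j; rewrite mxE; case: (boolP (adj (enum_val i) (enum_val j))) => a.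
      by rewrite (kastE a) rpredX ?rpredN ?rpred1.
    by rewrite kast0 ?rpred0.
  - by apply/matrixP=> i j; rewrite !mxE kast_skew.
  - move=> j; under eq_bigr do rewrite mxE norm_kast adj_sym.
    by rewrite (sum_enum_val (fun v => (adj (enum_val j) v)%:R)) sum_adj.
move=> H; rewrite -(ler_nat C) !natrX (exprM _ 2 2).
have q0 : 0 <= 3 * (23 / 24) ^+ 2 :> C by rewrite mulr_ge0 // exprn_ge0 // divr_ge0.
apply: le_trans (lerXn2r 2 _ _ H) _; rewrite ?nnegrE ?ler0n ?exprn_ge0 //.
rewrite -exprM mulnC exprM lerXn2r ?nnegrE ?exprn_ge0 //.
(* A convenient intermediate value, since (14/5)^2 = 7.84 < 8. *)
have q1 : 3 * (23 / 24) ^+ 2 <= 14 / 5 :> C.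
  by rewrite -subr_ge0 (_ : _ - _ = 43 / 960) ?divr_ge0 //; field.
apply: le_trans (lerXn2r 2 _ _ q1) _; rewrite ?nnegrE ?divr_ge0 //.
by rewrite -subr_ge0 (_ : _ - _ = 4 / 25) ?divr_ge0 //; field.
Qed.

End Kasteleyn.

Lemma perfmat_pow8_le (G : sgraph) : fullerene G -> perfmat G ^ 8 <= 8 ^ #|G|.
Proof.
move=> [cubicG connG [sigma [rotG eulerG] faceG]].
have [s srev sodd] := odd_face_orientation cubicG rotG connG eulerG.
apply: leq_trans (even_walks_bound cubicG rotG connG eulerG srev sodd
  (no_four_cycle cubicG rotG faceG connG eulerG) algC).
by rewrite (expnM _ 2 4) leq_exp2r // perfmat_sqr_le.
Qed.

(** * Deduction of the three bounds *)

Local Open Scope ring_scope.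

Lemma powR_expr (R : realType) (a x : R) n : (a `^ x) ^+ n = a `^ (x * n%:R).
Proof. by rewrite powRrM powR_mulrn ?powR_ge0. Qed.

Theorem corollary5p3 (R : realType) (G : sgraph) (fullG : fullerene G) :
  let n := #|G| in
  let k := ((5 * n - 4) %/ 12)%N in
  [/\ hamiltonian G -> (4 %| n)%N ->
        (perfmat G)%:R <= 8 `^ (n%:R / 8) :> R,
      hamiltonian G -> ~~ (4 %| n)%N ->
        (perfmat G)%:R <= 8 `^ ((n%:R - 2) / 8) * Num.sqrt 3 :> R &
      (perfmat G)%:R <=
        8 `^ (1 / 4 * k%:R) * 3 `^ ((n%:R - 2 * k%:R) / 4) :> R].
Proof.
move=> n k.
have bound (x : R) : 0 <= x -> 8 ^+ n <= x ^+ 8 -> (perfmat G)%:R <= x.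
  move=> x0 H; rewrite -(@ler_pXn2r _ 8) ?nnegrE //; apply: le_trans H.
  by rewrite -!natrX ler_nat; exact: perfmat_pow8_le.
have p8 : 0 <= 8 :> R by [].
have n8 : 8 != 0 :> R by rewrite pnatr_eq0.
split=> [_ _|_ _|]; apply: bound; rewrite ?mulr_ge0 ?powR_ge0 ?sqrtr_ge0 //.
- by rewrite powR_expr (divfK n8) powR_mulrn.
(* The eighth power of the bound is 8^n * 8^(-2) * 3^4, and 81 >= 64. *)
- rewrite exprMn powR_expr (divfK n8) powRD; last by rewrite n8 implybT.
  rewrite powR_mulrn // (exprM _ 2 4) sqr_sqrtr // powRN powR_mulrn // -mulrA ler_peMr
    ?exprn_ge0 //.
  lra.
- rewrite exprMn !powR_expr.
  (* This makes n - 2k a genuine natural number; it remains to compare 9^(n-2k) with 8^(n-2k). *)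
  have k2 : (2 * k <= n)%N by rewrite /k; lia.
  have -> : 1 / 4 * k%:R * 8 = (2 * k)%:R :> R by rewrite natrM; field.
  have -> : (n%:R - 2 * k%:R) / 4 * 8 = (2 * (n - 2 * k))%:R :> R.
    by rewrite natrM natrB // natrM; field.
  rewrite !powR_mulrn // [3 ^+ _]exprM -{1}(subnKC k2) exprD ler_pM2l ?exprn_gt0 //.
  rewrite lerXn2r ?nnegrE ?exprn_ge0 //; lra.
Qed.
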